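(* Let $\mathbb{H}=(\bar H=(H,e_H,m_H),\underline{H}=(H,\varepsilon_H,\delta_H))$ be a bialgebra in $\mathcal V$, let $\mathbb{A}=((A,\alpha_A),e_A,m_A)$ be a right $\mathbb{H}$-comodule algebra, and let $\lambda_{(A,\alpha_A)}:H\otimes A\to A\otimes H$ be the corresponding entwining structure. Then the functor $$\bar F:\mathcal V_{A^{\underline H}}\to\mathcal V_{\mathbb A}^{\underline H}(\lambda_{(A,\alpha_A)}),\qquad (X,\nu_X)\mapsto (X\otimes_{A^{\underline H}}A,\;X\otimes_{A^{\underline H}}m_A,\;X\otimes_{A^{\underline H}}\alpha_A)$$ is an equivalence of categories if and only if the extension-of-scalars functor $$F_{i_A}:\mathcal V_{A^{\underline H}}\to\mathcal V_A,\qquad (X,\nu_X)\mapsto (X\otimes_{A^{\underline H}}A,\;X\otimes_{A^{\underline H}}m_A)$$ is comonadic and $A$ is $\underline H$-Galois, in the sense that the canonical morphism $\mathrm{can}:A\otimes_{A^{\underline H}}A\to A\otimes H$ is an isomorphism.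
   Context: $\mathcal V=(V,\otimes,I)$ is a strict braided monoidal category with braiding $\sigma_{X,Y}:X\otimes Y\to Y\otimes X$, with equalizers and with coequalizers, and the tensor product preserves coequalizers in both variables. The name of an object also denotes its identity morphism. For an algebra (monoid) $B$ in $\mathcal V$, $\mathcal V_B$ is the category of right $B$-modules; $M\otimes_B N$ is the usual coequalizer. The tensor product of algebras $A,B$ is an algebra with $m_{A\otimes B}=(m_A\otimes m_B)(A\otimes\sigma_{B,A}\otimes B)$ and $e_{A\otimes B}=e_A\otimes e_B$. A bialgebra $\mathbb H$ is an object $H$ with an algebra structure $\bar H=(H,e_H,m_H)$ and a coalgebra structure $\underline H=(H,\varepsilon_H,\delta_H)$ such that $\varepsilon_H$ and $\delta_H$ are algebra morphisms. A right $\mathbb H$-comodule algebra is an algebra $(A,e_A,m_A)$ with a right $\underline H$-comodule structure $\alpha_A:A\to A\otimes H$ that is an algebra morphism from $A$ to $A\otimes\bar H$. The corresponding entwining structure is $\lambda_{(A,\alpha_A)}=(\varepsilon_H\otimes A\otimes H)\,\delta_{H\otimes A}:H\otimes A\to A\otimes H$, where $\delta_{H\otimes A}=(H\otimes A\otimes m_H)(H\otimes\sigma_{H,A}\otimes H)(\delta_H\otimes\alpha_A)$ is the tensor product comodule structure on $(H,\delta_H)\otimes(A,\alpha_A)$. For $\lambda:H\otimes A\to A\otimes H$, $\mathcal V^{\underline H}_{\mathbb A}(\lambda)$ is the category of triples $(X,\xi_X,\nu_X)$ with $(X,\xi_X:X\otimes A\to X)$ a right $A$-module, $(X,\nu_X:X\to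 X\otimes H)$ a right $\underline H$-comodule and $\nu_X\xi_X=(\xi_X\otimes H)(X\otimes\lambda)(\nu_X\otimes A)$; morphisms are morphisms of $\mathcal V$ that are both module and comodule morphisms. $i_A:A^{\underline H}\to A$ denotes the equalizer of $\alpha_A$ and $A\otimes e_H:A\to A\otimes H$; $A^{\underline H}$ carries an algebra structure making $i_A$ an algebra morphism, and $A$ is an $A^{\underline H}$-bimodule via $i_A$. The morphism $\mathrm{can}$ is the one induced on the quotient $A\otimes_{A^{\underline H}}A$ by $(m_A\otimes H)(A\otimes\alpha_A):A\otimes A\to A\otimes H$. A functor with a right adjoint is comonadic if the Eilenberg–Moore comparison functor to the category of coalgebras over the induced comonad is an equivalence; the right adjoint of $F_{i_A}$ is restriction of scalars along $i_A$. *)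

(* Defs.v *)
From mathcomp Require Import ssreflect ssrfun ssrbool seq.
From mathcomp.classical Require Import boolp.

Set Implicit Arguments.
Unset Strict Implicit.
Unset Printing Implicit Defensive.

Declare Scope cat_scope.
Delimit Scope cat_scope with cat.
Local Open Scope cat_scope.
Local Obligation Tactic := cbn beta.

Reserved Notation "g ∘ f" (at level 44, right associativity).
Reserved Notation "f ⊗ g" (at level 39, right associativity).

Record category := Category {
  Ob :> Type;
  Hom : Ob -> Ob -> Type;
  idm : forall X, Hom X X;
  compm : forall X Y Z, Hom Y Z -> Hom X Y -> Hom X Z;
  compm1 : forall X Y (f : Hom X Y), compm f (idm X) = f;
  comp1m : forall X Y (f : Hom X Y), compm (idm Y) f = f;
  compmA : forall X Y Z T (h : Hom Z T) (g : Hom Y Z) (f : Hom X Y),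
    compm h (compm g f) = compm (compm h g) f }.
Arguments Hom {c} _ _.
Arguments idm {c} X.
Arguments compm {c X Y Z} _ _.

Definition is_iso (C : category) (X Y : C) (f : Hom X Y) : Prop :=
  exists g : Hom Y X, compm g f = idm X /\ compm f g = idm Y.

Record functor (C D : category) := Functor {
  fob :> C -> D;
  fmap : forall X Y, Hom X Y -> Hom (fob X) (fob Y);
  fmap1 : forall X, fmap (idm X) = idm (fob X);
  fmapM : forall X Y Z (g : Hom Y Z) (f : Hom X Y),
    fmap (compm g f) = compm (fmap g) (fmap f) }.
Arguments fmap {C D} F {X Y} _ : rename.

Program Definition id_functor (C : category) : functor C C :=
  @Functor C C (fun X => X) (fun _ _ f => f) _ _.
Next Obligation. by []. Qed.
Next Obligation. by []. Qed.

Program Definition comp_functor (C D E : category) (G : functor D E)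
    (F : functor C D) : functor C E :=
  @Functor C E (fun X => G (F X)) (fun _ _ f => fmap G (fmap F f)) _ _.
Next Obligation. by move=> * /=; rewrite !fmap1. Qed.
Next Obligation. by move=> * /=; rewrite !fmapM. Qed.

Record nat_trans (C D : category) (F G : functor C D) := NatTrans {
  nt :> forall X : C, Hom (F X) (G X);
  ntP : forall X Y (f : Hom X Y), compm (nt Y) (fmap F f) = compm (fmap G f) (nt X) }.

Definition nat_isomorphic (C D : category) (F G : functor C D) : Prop :=
  exists t : nat_trans F G, forall X, is_iso (t X).

Definition is_equivalence (C D : category) (F : functor C D) : Prop :=
  exists G : functor D C,
    nat_isomorphic (comp_functor G F) (id_functor C) /\
    nat_isomorphic (comp_functor F G) (id_functor D).

Record adjunction (C D : category) (F : functor C D) (G : functor D C) := Adjunction {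
  adj_unit : nat_trans (id_functor C) (comp_functor G F);
  adj_counit : nat_trans (comp_functor F G) (id_functor D);
  adj_triangleF : forall X : C,
    compm (adj_counit (F X)) (fmap F (adj_unit X)) = idm (F X);
  adj_triangleG : forall Y : D,
    compm (fmap G (adj_counit Y)) (adj_unit (G Y)) = idm (G Y) }.

Record comonad (D : category) := Comonad {
  cm_fun :> functor D D;
  cm_counit : nat_trans cm_fun (id_functor D);
  cm_comult : nat_trans cm_fun (comp_functor cm_fun cm_fun);
  cm_counitl : forall Y : D, compm (cm_counit (cm_fun Y)) (cm_comult Y) = idm (cm_fun Y);
  cm_counitr : forall Y : D,
    compm (fmap cm_fun (cm_counit Y)) (cm_comult Y) = idm (cm_fun Y);
  cm_coassoc : forall Y : D, compm (cm_comult (cm_fun Y)) (cm_comult Y)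
    = compm (fmap cm_fun (cm_comult Y)) (cm_comult Y) }.

Section Coalgebras.
Variables (D : category) (T : comonad D).

Record cm_coalgebra := CmCoalgebra {
  cmc_ob : D;
  cmc_map : Hom cmc_ob (T cmc_ob);
  cmc_counit : compm (cm_counit T cmc_ob) cmc_map = idm cmc_ob;
  cmc_coassoc : compm (cm_comult T cmc_ob) cmc_map = compm (fmap T cmc_map) cmc_map }.

Definition cm_coalgebra_hom (X Y : cm_coalgebra) :=
  {f : Hom (cmc_ob X) (cmc_ob Y) |
     compm (cmc_map Y) f = compm (fmap T f) (cmc_map X)}.

Program Definition cm_coalgebras : category :=
  @Category cm_coalgebra cm_coalgebra_hom
    (fun X => exist _ (idm (cmc_ob X)) _)
    (fun X Y Z g f => exist _ (compm (sval g) (sval f)) _) _ _ _.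
Next Obligation. by move=> X; rewrite fmap1 compm1 comp1m. Qed.
Next Obligation.
by move=> X Y Z [g gP] [f fP] /=; rewrite fmapM compmA gP -!compmA fP.
Qed.
Next Obligation. by move=> X Y [f fP]; apply: eq_exist => /=; rewrite compm1. Qed.
Next Obligation. by move=> X Y [f fP]; apply: eq_exist => /=; rewrite comp1m. Qed.
Next Obligation. by move=> *; apply: eq_exist => /=; rewrite compmA. Qed.
End Coalgebras.

Section InducedComonad.
Variables (C D : category) (F : functor C D) (G : functor D C) (a : adjunction F G).

Program Definition adj_comult : nat_trans (comp_functor F G)
    (comp_functor (comp_functor F G) (comp_functor F G)) :=
  @NatTrans _ _ (comp_functor F G) (comp_functor (comp_functor F G) (comp_functor F G))
    (fun Y => fmap F (adj_unit a (G Y))) _.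
Next Obligation. by move=> X Y f /=; rewrite -!fmapM; congr fmap; exact: (ntP (adj_unit a) (fmap G f)). Qed.

Program Definition adj_comonad : comonad D :=
  @Comonad D (comp_functor F G) (adj_counit a) adj_comult _ _ _.
Next Obligation. by move=> Y; exact: (adj_triangleF a). Qed.
Next Obligation. by move=> Y /=; rewrite -fmapM adj_triangleG fmap1. Qed.
Next Obligation.
move=> Y /=; rewrite -!fmapM; congr fmap.
exact: (ntP (adj_unit a) (adj_unit a (G Y))).
Qed.

Program Definition comparison : functor C (cm_coalgebras adj_comonad) :=
  @Functor C (cm_coalgebras adj_comonad)
    (fun X => @CmCoalgebra D adj_comonad (F X) (fmap F (adj_unit a X)) _ _)
    (fun X Y f => exist _ (fmap F f) _) _ _.
Next Obligation. by move=> X; exact: (adj_triangleF a). Qed.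
Next Obligation.
move=> X /=; rewrite -!fmapM; congr fmap.
exact: (ntP (adj_unit a) (adj_unit a X)).
Qed.
Next Obligation.
by move=> X Y f /=; rewrite -!fmapM; congr fmap; apply: (ntP (adj_unit a) f).
Qed.
Next Obligation. by move=> X; apply: eq_exist; rewrite fmap1. Qed.
Next Obligation. by move=> X Y Z g f; apply: eq_exist; rewrite /= fmapM. Qed.

Definition is_comonadic : Prop := is_equivalence comparison.
End InducedComonad.

Section Limits.
Variables (C : category).

Definition is_equalizer (X Y E : C) (f g : Hom X Y) (i : Hom E X) : Prop :=
  compm f i = compm g i /\
  forall T (h : Hom T X), compm f h = compm g h -> exists! k, compm i k = h.

Definition is_coequalizer (X Y Q : C) (f g : Hom X Y) (q : Hom Y Q) : Prop :=
  compm q f = compm q g /\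
  forall T (h : Hom Y T), compm h f = compm h g -> exists! k, compm k q = h.

Definition eq_lift (X Y E T : C) (f g : Hom X Y) (i : Hom E X)
  (iP : is_equalizer f g i) (h : Hom T X) (hP : compm f h = compm g h) : Hom T E :=
  sval (cid (iP.2 T h hP)).

Definition coeq_desc (X Y Q T : C) (f g : Hom X Y) (q : Hom Y Q)
  (qP : is_coequalizer f g q) (h : Hom Y T) (hP : compm h f = compm h g) : Hom Q T :=
  sval (cid (qP.2 T h hP)).

Lemma eq_liftE (X Y E T : C) (f g : Hom X Y) (i : Hom E X)
  (iP : is_equalizer f g i) (h : Hom T X) (hP : compm f h = compm g h) :
  compm i (eq_lift iP hP) = h.
Proof. by rewrite /eq_lift; case: cid => k []. Qed.

Lemma eq_mono (X Y E T : C) (f g : Hom X Y) (i : Hom E X) (h k : Hom T E) :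
  is_equalizer f g i -> compm i h = compm i k -> h = k.
Proof.
move=> [e u] hk; have [|l [_ lu]] := u T (compm i h); first by rewrite !compmA e.
by rewrite -(lu h) // -(lu k).
Qed.

Lemma coeq_descE (X Y Q T : C) (f g : Hom X Y) (q : Hom Y Q)
  (qP : is_coequalizer f g q) (h : Hom Y T) (hP : compm h f = compm h g) :
  compm (coeq_desc qP hP) q = h.
Proof. by rewrite /coeq_desc; case: cid => k []. Qed.

Lemma coeq_epi (X Y Q T : C) (f g : Hom X Y) (q : Hom Y Q) (h k : Hom Q T) :
  is_coequalizer f g q -> compm h q = compm k q -> h = k.
Proof.
move=> [e u] hk; have [|l [_ lu]] := u T (compm h q); first by rewrite -!compmA e.
by rewrite -(lu h) // -(lu k).
Qed.
End Limits.

Definition eqhom (C : category) (X Y : C) (e : X = Y) : Hom X Y :=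
  match e with erefl => idm X end.

(** Strictness is equality of objects, so the morphism laws compare morphisms
  along the identities [eqhom]. *)

Record strict_monoidal := StrictMonoidal {
  sm_cat :> category;
  tenO : sm_cat -> sm_cat -> sm_cat;
  unitO : sm_cat;
  tenM : forall X Y X' Y' : sm_cat,
    Hom X Y -> Hom X' Y' -> Hom (tenO X X') (tenO Y Y');
  tenM1 : forall X X', tenM (idm X) (idm X') = idm (tenO X X');
  tenMM : forall X Y Z X' Y' Z' (g : Hom Y Z) (f : Hom X Y)
      (g' : Hom Y' Z') (f' : Hom X' Y'),
    tenM (compm g f) (compm g' f') = compm (tenM g g') (tenM f f');
  tenOA : forall X Y Z, tenO (tenO X Y) Z = tenO X (tenO Y Z);
  ten1O : forall X, tenO unitO X = X;
  tenO1 : forall X, tenO X unitO = X;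
  tenMA : forall X Y X' Y' X'' Y'' (f : Hom X Y) (f' : Hom X' Y') (f'' : Hom X'' Y''),
    compm (eqhom (tenOA Y Y' Y'')) (tenM (tenM f f') f'')
    = compm (tenM f (tenM f' f'')) (eqhom (tenOA X X' X''));
  ten1M : forall X Y (f : Hom X Y),
    compm (eqhom (ten1O Y)) (tenM (idm unitO) f) = compm f (eqhom (ten1O X));
  tenM1r : forall X Y (f : Hom X Y),
    compm (eqhom (tenO1 Y)) (tenM f (idm unitO)) = compm f (eqhom (tenO1 X)) }.
Arguments tenO {s} _ _.
Arguments unitO {s}.
Arguments tenM {s X Y X' Y'} _ _.

(** In a strict monoidal category tensor products need no brackets: the word
  [:: X1; ...; Xn] stands for X1 ⊗ ... ⊗ Xn and [::] for I, and a morphism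
  [whom u v] is a morphism of V between the products of the two words.
  Concatenation of explicit words computes, so that no identity morphism
  between equal objects has to be written. *)

Section Words.
Variable V : strict_monoidal.
Implicit Types u v w : seq V.

Fixpoint prodw (u : seq V) : V :=
  match u with
  | [::] => unitO
  | X :: u' => match u' with [::] => X | _ :: _ => tenO X (prodw u') end
  end.

Definition whom u v : Type := Hom (prodw u) (prodw v).

Lemma prodw_cons (X : V) u : tenO X (prodw u) = prodw (X :: u).
Proof. by case: u => //=; apply: tenO1. Qed.

Lemma prodw_cat u v : tenO (prodw u) (prodw v) = prodw (u ++ v).
Proof.
elim: u => [|X u IHu]; first exact: ten1O.
by rewrite -prodw_cons tenOA IHu prodw_cons.
Qed.

Definition wid u : whom u u := idm (prodw u).
Definition wcomp u v w (g : whom v w) (f : whom u v) : whom u w := compm g f.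
Definition wten u v u' v' (f : whom u v) (f' : whom u' v') : whom (u ++ u') (v ++ v') :=
  compm (eqhom (prodw_cat v v'))
    (compm (tenM f f') (eqhom (esym (prodw_cat u u')))).
End Words.

Arguments whom {V} u v.
Arguments wid {V} u.
Arguments wcomp {V u v w} g f.
Arguments wten {V u v u' v'} f f'.
Notation "g ∘ f" := (wcomp g f) : cat_scope.
Notation "f ⊗ g" := (wten f g) : cat_scope.
Notation id1 X := (wid [:: X]).

(** Equality of morphisms whose sources and targets are only propositionally equal *)

Section Heq.
Variable V : strict_monoidal.
Implicit Types u v w : seq V.

Definition hcast (C : category) (X Y X' Y' : C) (eX : X = X') (eY : Y = Y')
  (f : Hom X Y) : Hom X' Y' :=
  match eX in _ = X'', eY in _ = Y'' return Hom X'' Y'' with erefl, erefl => f end.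

Definition heq (C : category) (X Y X' Y' : C) (f : Hom X Y) (g : Hom X' Y') : Prop :=
  exists (eX : X = X') (eY : Y = Y'), hcast eX eY f = g.

Lemma heq_eq (C : category) (X Y : C) (f g : Hom X Y) : heq f g -> f = g.
Proof.
move=> [eX [eY <-]].
by rewrite (Prop_irrelevance eX erefl) (Prop_irrelevance eY erefl).
Qed.

Lemma heq_refl (C : category) (X Y : C) (f : Hom X Y) : heq f f.
Proof. by exists erefl, erefl. Qed.

Lemma eq_heq (C : category) (X Y : C) (f g : Hom X Y) : f = g -> heq f g.
Proof. by move->; apply: heq_refl. Qed.

Lemma heq_sym (C : category) (X Y X' Y' : C) (f : Hom X Y) (g : Hom X' Y') :
  heq f g -> heq g f.
Proof. by move=> [eX [eY <-]]; destruct eX, eY; apply: heq_refl. Qed.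

Lemma heq_trans (C : category) (X Y X' Y' X'' Y'' : C) (f : Hom X Y)
  (g : Hom X' Y') (h : Hom X'' Y'') : heq f g -> heq g h -> heq f h.
Proof. by move=> [eX [eY <-]]; destruct eX, eY. Qed.

Lemma heq_comp (C : category) (X Y Z X' Y' Z' : C) (g : Hom Y Z) (f : Hom X Y)
  (g' : Hom Y' Z') (f' : Hom X' Y') :
  heq g g' -> heq f f' -> heq (compm g f) (compm g' f').
Proof.
move=> [eY [eZ <-]] [eX [eY' <-]]; destruct eX, eY, eZ.
by rewrite (Prop_irrelevance eY' erefl); apply: heq_refl.
Qed.

Lemma heq_tenM (X Y X1 Y1 X' Y' X1' Y1' : V) (f : Hom X Y) (g : Hom X1 Y1)
  (f' : Hom X' Y') (g' : Hom X1' Y1') :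
  heq f f' -> heq g g' -> heq (tenM f g) (tenM f' g').
Proof.
move=> [e1 [e2 <-]] [e3 [e4 <-]]; destruct e1, e2, e3, e4; exact: heq_refl.
Qed.

Lemma heq_idm (C : category) (X Y : C) : X = Y -> heq (idm X) (idm Y).
Proof. by move=> e; destruct e; apply: heq_refl. Qed.

Lemma heq_eqhoml (C : category) (X Y Z : C) (e : Y = Z) (f : Hom X Y) :
  heq (compm (eqhom e) f) f.
Proof. by destruct e; rewrite comp1m; apply: heq_refl. Qed.

Lemma heq_eqhomr (C : category) (X Y Z : C) (e : Z = X) (f : Hom X Y) :
  heq (compm f (eqhom e)) f.
Proof. by destruct e; rewrite compm1; apply: heq_refl. Qed.

Lemma heq_wten u v u' v' (f : whom u v) (f' : whom u' v') : heq (f ⊗ f') (tenM f f').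
Proof. exact: heq_trans (heq_eqhoml _ _) (heq_eqhomr _ _). Qed.

Lemma wten_letters (X Y X' Y' : V) (f : Hom X Y) (f' : Hom X' Y') :
  wten (u := [:: X]) (v := [:: Y]) (u' := [:: X']) (v' := [:: Y']) f f' = tenM f f'.
Proof. by apply: heq_eq; apply: heq_wten. Qed.

Lemma heq_tenMA (X Y X' Y' X'' Y'' : V) (f : Hom X Y) (f' : Hom X' Y') (f'' : Hom X'' Y'') :
  heq (tenM (tenM f f') f'') (tenM f (tenM f' f'')).
Proof.
apply: heq_trans (heq_sym (heq_eqhoml (tenOA _ _ _) _)) _.
by rewrite tenMA; apply: heq_eqhomr.
Qed.

Lemma heq_ten1M (X Y : V) (f : Hom X Y) : heq (tenM (idm unitO) f) f.
Proof.
apply: heq_trans (heq_sym (heq_eqhoml (ten1O _) _)) _.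
by rewrite ten1M; apply: heq_eqhomr.
Qed.

Lemma heq_tenM1 (X Y : V) (f : Hom X Y) : heq (tenM f (idm unitO)) f.
Proof.
apply: heq_trans (heq_sym (heq_eqhoml (tenO1 _) _)) _.
by rewrite tenM1r; apply: heq_eqhomr.
Qed.

Lemma wcomp1 u v (f : whom u v) : f ∘ wid u = f.
Proof. exact: compm1. Qed.

Lemma wcomp1l u v (f : whom u v) : wid v ∘ f = f.
Proof. exact: comp1m. Qed.

Lemma wcompA u v w x (h : whom w x) (g : whom v w) (f : whom u v) :
  h ∘ (g ∘ f) = (h ∘ g) ∘ f.
Proof. exact: compmA. Qed.

Lemma wten1 u v : wid u ⊗ wid v = wid (u ++ v).
Proof.
apply: heq_eq; apply: heq_trans (heq_wten _ _) _.
by rewrite tenM1; apply: heq_idm; apply: prodw_cat.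
Qed.

Lemma wtenM u v w u' v' w' (g : whom v w) (f : whom u v) (g' : whom v' w')
  (f' : whom u' v') : (g ∘ f) ⊗ (g' ∘ f') = (g ⊗ g') ∘ (f ⊗ f').
Proof.
apply: heq_eq; apply: heq_trans (heq_wten _ _) _; rewrite tenMM.
by apply: heq_comp; apply/heq_sym/heq_wten.
Qed.

Lemma heq_wten2 u v u' v' x y x' y' (f : whom u v) (f' : whom u' v')
  (g : whom x y) (g' : whom x' y') : heq f g -> heq f' g' -> heq (f ⊗ f') (g ⊗ g').
Proof.
move=> fg fg'; apply: heq_trans (heq_wten _ _) _.
by apply: heq_trans (heq_sym (heq_wten _ _)); apply: heq_tenM.
Qed.

Lemma heq_wtenA u v u' v' u'' v'' (f : whom u v) (f' : whom u' v') (f'' : whom u'' v'') :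
  heq ((f ⊗ f') ⊗ f'') (f ⊗ f' ⊗ f'').
Proof.
apply: heq_trans (heq_wten _ _) _.
apply: heq_trans (heq_tenM (heq_wten _ _) (heq_refl _)) _.
apply: heq_trans (heq_tenMA _ _ _) _.
apply: heq_sym; apply: heq_trans (heq_wten _ _) _.
exact: heq_tenM (heq_refl _) (heq_wten _ _).
Qed.

Lemma wten1l u v (f : whom u v) : wid [::] ⊗ f = f.
Proof. apply: heq_eq; exact: (heq_trans (heq_wten (wid [::]) f) (heq_ten1M f)). Qed.

Lemma heq_wten1r u v (f : whom u v) : heq (f ⊗ wid [::]) f.
Proof. exact: (heq_trans (heq_wten f (wid [::])) (heq_tenM1 f)). Qed.

Definition wcast u v u' v' (eu : u = u') (ev : v = v') (f : whom u v) : whom u' v' :=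
  match eu in _ = u'', ev in _ = v'' return whom u'' v'' with erefl, erefl => f end.

Lemma heq_wcast u v u' v' (eu : u = u') (ev : v = v') (f : whom u v) :
  heq (wcast eu ev f) f.
Proof. by destruct eu, ev; apply: heq_refl. Qed.

(* For explicit words, [eu] and [ev] can be [erefl] and [wcast] disappears. *)
Lemma wtenA u v u' v' u'' v'' (f : whom u v) (f' : whom u' v') (f'' : whom u'' v'') eu ev :
  wcast eu ev ((f ⊗ f') ⊗ f'') = f ⊗ f' ⊗ f''.
Proof. by apply: heq_eq; apply: heq_trans (heq_wcast _ _ _) (heq_wtenA _ _ _). Qed.

Lemma wten1r u v (f : whom u v) eu ev : wcast eu ev (f ⊗ wid [::]) = f.
Proof. by apply: heq_eq; apply: heq_trans (heq_wcast _ _ _) (heq_wten1r _). Qed.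
End Heq.

Record strict_braided := StrictBraided {
  sb_mon :> strict_monoidal;
  braid : forall X Y : sb_mon, whom [:: X; Y] [:: Y; X];
  braid_iso : forall X Y, is_iso (braid X Y);
  braid_nat : forall (X Y X' Y' : sb_mon) (f : Hom X Y) (f' : Hom X' Y'),
    compm (braid Y Y') (tenM f f') = compm (tenM f' f) (braid X X');
  braid_hexl : forall X Y Z : sb_mon,
    compm (eqhom (tenOA Y Z X)) (braid X (tenO Y Z))
    = (id1 Y ⊗ braid X Z) ∘ (braid X Y ⊗ id1 Z);
  braid_hexr : forall X Y Z : sb_mon,
    compm (braid (tenO X Y) Z) (eqhom (esym (tenOA X Y Z)))
    = (braid X Z ⊗ id1 Y) ∘ (id1 X ⊗ braid Y Z) }.
Arguments braid {s} X Y.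

Record base_category := BaseCategory {
  bc_braided :> strict_braided;
  equ_ob : forall (X Y : bc_braided) (f g : Hom X Y), bc_braided;
  equ : forall (X Y : bc_braided) (f g : Hom X Y), Hom (equ_ob f g) X;
  equP : forall (X Y : bc_braided) (f g : Hom X Y), is_equalizer f g (equ f g);
  coequ_ob : forall (X Y : bc_braided) (f g : Hom X Y), bc_braided;
  coequ : forall (X Y : bc_braided) (f g : Hom X Y), Hom Y (coequ_ob f g);
  coequP : forall (X Y : bc_braided) (f g : Hom X Y), is_coequalizer f g (coequ f g);
  tenM_coeql : forall (Z X Y Q : bc_braided) (f g : Hom X Y) (q : Hom Y Q),
    is_coequalizer f g q ->
    is_coequalizer (tenM (idm Z) f) (tenM (idm Z) g) (tenM (idm Z) q);
  tenM_coeqr : forall (Z X Y Q : bc_braided) (f g : Hom X Y) (q : Hom Y Q),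
    is_coequalizer f g q ->
    is_coequalizer (tenM f (idm Z)) (tenM g (idm Z)) (tenM q (idm Z)) }.

(* Associativity of a tensor product of morphisms between explicit words. *)
Ltac wassoc f g h :=
  let E := fresh in
  pose proof (wtenA f g h erefl erefl) as E; cbv beta iota delta [wcast] in E;
  rewrite E; clear E.
Ltac wassocV f g h :=
  let E := fresh in
  pose proof (wtenA f g h erefl erefl) as E; cbv beta iota delta [wcast] in E;
  rewrite -E; clear E.

(* Merges two composable tensor products, by [wtenM]. *)
Ltac wmerge :=
  match goal with
  | |- context [ wcomp (wten ?g ?g') (wten ?f ?f') ] => rewrite -(wtenM g f g' f')
  | |- context [ wcomp (wten ?g ?g') (wcomp (wten ?f ?f') ?k) ] =>
      rewrite (wcompA (wten g g') (wten f f') k) -(wtenM g f g' f')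
  end.

Section Bialgebras.
Variable V : strict_braided.
Implicit Types u v : seq V.

Record alg_ops u := AlgOps { mul : whom (u ++ u) u; one : whom [::] u }.

Definition is_alg_hom u v (a : alg_ops u) (b : alg_ops v) (f : whom u v) : Prop :=
  f ∘ mul a = mul b ∘ (f ⊗ f) /\ f ∘ one a = one b.

Definition unit_alg : alg_ops [::] := @AlgOps [::] (wid [::]) (wid [::]).

Definition ten_alg (A B : V) (a : alg_ops [:: A]) (b : alg_ops [:: B]) :
    alg_ops [:: A; B] :=
  @AlgOps [:: A; B] ((mul a ⊗ mul b) ∘ (id1 A ⊗ braid B A ⊗ id1 B)) (one a ⊗ one b).

Record algebra_on (A : V) := AlgebraOn {
  alg_str :> alg_ops [:: A];
  mul_assoc : mul alg_str ∘ (mul alg_str ⊗ id1 A) = mul alg_str ∘ (id1 A ⊗ mul alg_str);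
  mul_onel : mul alg_str ∘ (one alg_str ⊗ id1 A) = id1 A;
  mul_oner : mul alg_str ∘ (id1 A ⊗ one alg_str) = id1 A }.

Record coalgebra_on (C : V) := CoalgebraOn {
  comult : whom [:: C] [:: C; C];
  counit : whom [:: C] [::];
  comult_coassoc : (comult ⊗ id1 C) ∘ comult = (id1 C ⊗ comult) ∘ comult;
  comult_counitl : (counit ⊗ id1 C) ∘ comult = id1 C;
  comult_counitr : (id1 C ⊗ counit) ∘ comult = id1 C }.

Record bialgebra := Bialgebra {
  bi_ob :> V;
  bi_alg : algebra_on bi_ob;
  bi_coalg : coalgebra_on bi_ob;
  bi_counitP : is_alg_hom bi_alg unit_alg (counit bi_coalg);
  bi_comultP : is_alg_hom bi_alg (ten_alg bi_alg bi_alg) (comult bi_coalg) }.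

Definition is_rmodule (A : V) (a : algebra_on A) (X : V) (x : whom [:: X; A] [:: X]) : Prop :=
  x ∘ (x ⊗ id1 A) = x ∘ (id1 X ⊗ mul a) /\ x ∘ (id1 X ⊗ one a) = id1 X.

Definition is_lmodule (A : V) (a : algebra_on A) (X : V) (x : whom [:: A; X] [:: X]) : Prop :=
  x ∘ (id1 A ⊗ x) = x ∘ (mul a ⊗ id1 X) /\ x ∘ (one a ⊗ id1 X) = id1 X.

Definition is_rcomodule (C : V) (c : coalgebra_on C) (X : V)
    (x : whom [:: X] [:: X; C]) : Prop :=
  (x ⊗ id1 C) ∘ x = (id1 X ⊗ comult c) ∘ x /\ (id1 X ⊗ counit c) ∘ x = id1 X.

Record comodule_algebra (H : bialgebra) := ComoduleAlgebra {
  ca_ob :> V;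
  ca_alg : algebra_on ca_ob;
  ca_coact : whom [:: ca_ob] [:: ca_ob; bi_ob H];
  ca_coactP : is_rcomodule (bi_coalg H) ca_coact;
  ca_coact_alg : is_alg_hom ca_alg (ten_alg ca_alg (bi_alg H)) ca_coact }.

(** The coaction of the tensor product of two right H-comodules *)
Definition ten_coact (H : bialgebra) (X Y : V) (x : whom [:: X] [:: X; bi_ob H])
    (y : whom [:: Y] [:: Y; bi_ob H]) : whom [:: X; Y] [:: X; Y; bi_ob H] :=
  (id1 X ⊗ id1 Y ⊗ mul (bi_alg H)) ∘ (id1 X ⊗ braid (bi_ob H) Y ⊗ id1 (bi_ob H)) ∘ (x ⊗ y).

Definition entwining (H : bialgebra) (A : comodule_algebra H) :
    whom [:: bi_ob H; ca_ob A] [:: ca_ob A; bi_ob H] :=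
  (counit (bi_coalg H) ⊗ id1 (ca_ob A) ⊗ id1 (bi_ob H))
    ∘ ten_coact (comult (bi_coalg H)) (ca_coact A).

Record rmodule (A : V) (a : algebra_on A) := RModule {
  rm_ob : V;
  rm_act : whom [:: rm_ob; A] [:: rm_ob];
  rm_actP : is_rmodule a rm_act }.

Definition is_rlinear (A : V) (a : algebra_on A) (X Y : rmodule a)
    (f : whom [:: rm_ob X] [:: rm_ob Y]) : Prop :=
  f ∘ rm_act X = rm_act Y ∘ (f ⊗ id1 A).

Lemma is_rlinear1 (A : V) (a : algebra_on A) (X : rmodule a) :
  is_rlinear (Y := X) (id1 (rm_ob X)).
Proof. by rewrite /is_rlinear wten1 wcomp1l wcomp1. Qed.

Lemma is_rlinearM (A : V) (a : algebra_on A) (X Y Z : rmodule a)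
  (g : whom [:: rm_ob Y] [:: rm_ob Z]) (f : whom [:: rm_ob X] [:: rm_ob Y]) :
  is_rlinear g -> is_rlinear f -> is_rlinear (X := X) (Y := Z) (g ∘ f).
Proof.
rewrite /is_rlinear => gP fP.
by rewrite -wcompA fP wcompA gP -wcompA; wmerge; rewrite wcomp1.
Qed.

Program Definition rmodules (A : V) (a : algebra_on A) : category :=
  @Category (rmodule a)
    (fun X Y => {f : whom [:: rm_ob X] [:: rm_ob Y] | is_rlinear f})
    (fun X => exist _ (id1 (rm_ob X)) (is_rlinear1 X))
    (fun X Y Z g f => exist _ (sval g ∘ sval f) (is_rlinearM (proj2_sig g) (proj2_sig f)))
    _ _ _.
Next Obligation. by move=> A a X Y [f fP]; apply: eq_exist; rewrite /= wcomp1. Qed.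
Next Obligation. by move=> A a X Y [f fP]; apply: eq_exist; rewrite /= wcomp1l. Qed.
Next Obligation. by move=> *; apply: eq_exist; rewrite /= wcompA. Qed.

Section Entwined.
Variables (A C : V) (a : algebra_on A) (c : coalgebra_on C) (lam : whom [:: C; A] [:: A; C]).

Record emodule := EModule {
  em_mod :> rmodule a;
  em_coact : whom [:: rm_ob em_mod] [:: rm_ob em_mod; C];
  em_coactP : is_rcomodule c em_coact;
  em_compat : em_coact ∘ rm_act em_mod
    = (rm_act em_mod ⊗ id1 C) ∘ (id1 (rm_ob em_mod) ⊗ lam) ∘ (em_coact ⊗ id1 A) }.

Definition is_colinear (X Y : emodule) (f : whom [:: rm_ob X] [:: rm_ob Y]) : Prop :=
  em_coact Y ∘ f = (f ⊗ id1 C) ∘ em_coact X.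

Lemma is_colinear1 (X : emodule) : is_colinear (Y := X) (id1 (rm_ob X)).
Proof. by rewrite /is_colinear wten1 wcomp1l wcomp1. Qed.

Lemma is_colinearM (X Y Z : emodule)
  (g : whom [:: rm_ob Y] [:: rm_ob Z]) (f : whom [:: rm_ob X] [:: rm_ob Y]) :
  is_colinear g -> is_colinear f -> is_colinear (X := X) (Y := Z) (g ∘ f).
Proof.
rewrite /is_colinear => gP fP.
by rewrite wcompA gP -wcompA fP wcompA; wmerge; rewrite wcomp1.
Qed.

Program Definition emodules : category :=
  @Category emodule
    (fun X Y => {f : whom [:: rm_ob X] [:: rm_ob Y] | is_rlinear f /\ is_colinear f})
    (fun X => exist _ (id1 (rm_ob X)) (conj (is_rlinear1 X) (is_colinear1 X)))
    (fun X Y Z g f => exist _ (sval g ∘ sval f)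
       (conj (is_rlinearM (proj2_sig g).1 (proj2_sig f).1)
             (is_colinearM (proj2_sig g).2 (proj2_sig f).2))) _ _ _.
Next Obligation. by move=> X Y [f fP]; apply: eq_exist; rewrite /= wcomp1. Qed.
Next Obligation. by move=> X Y [f fP]; apply: eq_exist; rewrite /= wcomp1l. Qed.
Next Obligation. by move=> *; apply: eq_exist; rewrite /= wcompA. Qed.
End Entwined.

Lemma heq_braid1l (X : V) : heq (braid unitO X) (id1 X).
Proof.
have hI (Y Y' : V) : Y = Y' -> heq (braid Y X) (braid Y' X).
  by move=> e; destruct e; apply: heq_refl.
pose b : Hom X X := hcast (ten1O X) (tenO1 X) (braid unitO X).
have hb : heq (braid unitO X) b by exists (ten1O X), (tenO1 X).
have bb : compm b b = b.
  have h1 : heq (braid unitO X ⊗ id1 unitO) b.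
    exact: (heq_trans (heq_wten _ (id1 unitO)) (heq_trans (heq_tenM1 (braid unitO X)) hb)).
  have h2 : heq (id1 unitO ⊗ braid unitO X) b.
    exact: (heq_trans (heq_wten (id1 unitO) _) (heq_trans (heq_ten1M (braid unitO X)) hb)).
  apply: heq_eq; apply: (heq_trans (heq_sym (heq_comp h1 h2))).
  apply: (heq_trans (eq_heq (esym (braid_hexr unitO unitO X)))).
  apply: (heq_trans (heq_eqhomr (esym (tenOA unitO unitO X)) _)).
  exact: (heq_trans (hI _ _ (ten1O unitO)) hb).
have [c [cb _]] : is_iso b.
  rewrite /b; move: (ten1O X) (tenO1 X) (braid_iso unitO X).
  move: (braid unitO X); rewrite /whom /=; generalize (tenO unitO X) (tenO X unitO).
  by move=> Y Z f eY eZ; destruct eY, eZ.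
apply: heq_trans hb _; apply: eq_heq.
by rewrite -[b]comp1m -cb -compmA bb.
Qed.

Lemma wbraid_nat (X Y X' Y' : V) (f : whom [:: X] [:: Y]) (f' : whom [:: X'] [:: Y']) :
  braid Y Y' ∘ (f ⊗ f') = (f' ⊗ f) ∘ braid X X'.
Proof. by rewrite (wten_letters f f') (wten_letters f' f); exact: braid_nat. Qed.

Lemma braid_unitl (X Y : V) (e : whom [::] [:: Y]) :
  braid Y X ∘ (e ⊗ id1 X) = id1 X ⊗ e.
Proof.
pose e' : whom [:: unitO] [:: Y] := e.
apply: heq_eq; apply: (heq_trans (g := braid Y X ∘ (e' ⊗ id1 X))).
  exact: (heq_comp (heq_refl _) (heq_wten2 (f := e) (g := e') (heq_refl e) (heq_refl (id1 X)))).
rewrite wbraid_nat -(wcomp1 (id1 X ⊗ e)).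
exact: (heq_comp (heq_wten2 (f := id1 X) (g := id1 X) (f' := e') (g' := e)
  (heq_refl _) (heq_refl e)) (heq_braid1l X)).
Qed.

Lemma entwiningE (H : bialgebra) (A : comodule_algebra H) :
  entwining A = (id1 (ca_ob A) ⊗ mul (bi_alg H))
    ∘ (braid (bi_ob H) (ca_ob A) ⊗ id1 (bi_ob H)) ∘ (id1 (bi_ob H) ⊗ ca_coact A).
Proof.
rewrite /entwining /ten_coact.
set eps := counit _; set del := comult _; set m := mul _; set al := ca_coact A.
set h := bi_ob H; set X := ca_ob A.
rewrite !wcompA -[_ ∘ (id1 h ⊗ _)]wtenM wcomp1 wten1 wcomp1l.
rewrite -[_ ∘ (id1 h ⊗ _)]wtenM wcomp1.
set k := _ ∘ (braid h X ⊗ _).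
have -> : eps ⊗ k = k ∘ ((eps ⊗ id1 h) ⊗ wid [:: X; h]).
  wassoc eps (id1 h) (wid [:: X; h]); rewrite wten1.
  rewrite -{2}[k]wten1l; wmerge.
  by rewrite wcomp1l wcomp1.
rewrite -wcompA; wmerge.
have -> : (eps ⊗ id1 h) ∘ del = id1 h by apply: comult_counitl.
by rewrite wcomp1l.
Qed.

End Bialgebras.

Section Coinvariants.
Variables (V : base_category) (H : bialgebra V) (A : comodule_algebra H).
Let h : V := bi_ob H.
Let a : V := ca_ob A.
Let mH : whom [:: h; h] [:: h] := mul (bi_alg H).
Let eH : whom [::] [:: h] := one (bi_alg H).
Let mA : whom [:: a; a] [:: a] := mul (ca_alg A).
Let eA : whom [::] [:: a] := one (ca_alg A).

Definition coinv : V :=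
  equ_ob (ca_coact A : Hom (prodw [:: ca_ob A]) (prodw [:: ca_ob A; bi_ob H]))
         (id1 (ca_ob A) ⊗ one (bi_alg H)).

Definition coinv_in : whom [:: coinv] [:: ca_ob A] :=
  equ (ca_coact A : Hom (prodw [:: ca_ob A]) (prodw [:: ca_ob A; bi_ob H]))
      (id1 (ca_ob A) ⊗ one (bi_alg H)).

Let i : whom [:: coinv] [:: a] := coinv_in.

Lemma coinv_inP : is_equalizer
  (ca_coact A : Hom (prodw [:: ca_ob A]) (prodw [:: ca_ob A; bi_ob H]))
  (id1 (ca_ob A) ⊗ one (bi_alg H)) coinv_in.
Proof. exact: equP. Qed.

Lemma coinv_inE : ca_coact A ∘ coinv_in = (id1 (ca_ob A) ⊗ one (bi_alg H)) ∘ coinv_in.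
Proof. exact: coinv_inP.1. Qed.

Lemma coinv_inj u (f g : whom u [:: coinv]) : coinv_in ∘ f = coinv_in ∘ g -> f = g.
Proof. exact: (eq_mono coinv_inP). Qed.

Lemma coinv_mulP : ca_coact A ∘ (mul (ca_alg A) ∘ (coinv_in ⊗ coinv_in))
  = (id1 (ca_ob A) ⊗ one (bi_alg H)) ∘ (mul (ca_alg A) ∘ (coinv_in ⊗ coinv_in)).
Proof.
rewrite wcompA (ca_coact_alg A).1 /ten_alg /= -!wcompA.
rewrite -/mA -/mH -/eH -/a -/h.
wmerge; rewrite coinv_inE -/i -/eH -/a wtenM.
rewrite [in X in mA ⊗ mH ∘ X]wcompA.
have -> : (id1 a ⊗ braid h a ⊗ id1 h) ∘ ((id1 a ⊗ eH) ⊗ id1 a ⊗ eH)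
   = (id1 a ⊗ id1 a) ⊗ eH ⊗ eH.
  wassoc (id1 a) eH (id1 a ⊗ eH); wassocV eH (id1 a) eH.
  wmerge; wmerge; rewrite wcomp1 braid_unitl wcomp1l.
  wassoc (id1 a) eH eH; by wassocV (id1 a) (id1 a) (eH ⊗ eH).
rewrite wcompA; wmerge; rewrite wten1 wcomp1.
have -> : mH ∘ (eH ⊗ eH) = eH.
  have -> : eH ⊗ eH = (eH ⊗ id1 h) ∘ eH.
    have E : eH ⊗ eH = (eH ⊗ id1 h) ∘ (wid [::] ⊗ eH) by wmerge; rewrite wcomp1 wcomp1l.
    by rewrite E wten1l.
  by rewrite wcompA (mul_onel (bi_alg H)) wcomp1l.
congr wcomp.
have E : mA ⊗ eH = (id1 a ⊗ eH) ∘ (mA ⊗ wid [::]) by wmerge; rewrite wcomp1 wcomp1l.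
rewrite E; congr wcomp.
exact: (wten1r mA erefl erefl).
Qed.

Lemma coinv_oneP : ca_coact A ∘ one (ca_alg A)
  = (id1 (ca_ob A) ⊗ one (bi_alg H)) ∘ one (ca_alg A).
Proof.
rewrite (ca_coact_alg A).2 /=.
have E : eA ⊗ eH = (id1 a ⊗ eH) ∘ (eA ⊗ wid [::]) by wmerge; rewrite wcomp1 wcomp1l.
rewrite [LHS]E; congr wcomp.
exact: (wten1r eA erefl erefl).
Qed.

Definition coinv_mul : whom [:: coinv; coinv] [:: coinv] := eq_lift coinv_inP coinv_mulP.
Definition coinv_one : whom [::] [:: coinv] := eq_lift coinv_inP coinv_oneP.

Definition coinv_ops : alg_ops [:: coinv] :=
  @AlgOps _ [:: coinv] coinv_mul coinv_one.

Lemma coinv_in_alg : is_alg_hom coinv_ops (ca_alg A) coinv_in.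
Proof. by split; apply: eq_liftE. Qed.

Let iM : i ∘ coinv_mul = mA ∘ (i ⊗ i). Proof. exact: coinv_in_alg.1. Qed.
Let i1 : i ∘ coinv_one = eA. Proof. exact: coinv_in_alg.2. Qed.

Program Definition coinv_alg : algebra_on coinv := @AlgebraOn _ coinv coinv_ops _ _ _.
Next Obligation.
apply: coinv_inj; rewrite /= -/i !wcompA iM -!wcompA; wmerge; wmerge.
rewrite iM !wcomp1.
have -> : i ⊗ (mA ∘ (i ⊗ i)) = (id1 a ⊗ mA) ∘ (i ⊗ i ⊗ i) by wmerge; rewrite wcomp1l.
have -> : (mA ∘ (i ⊗ i)) ⊗ i = (mA ⊗ id1 a) ∘ ((i ⊗ i) ⊗ i) by wmerge; rewrite wcomp1l.
wassoc i i i; rewrite !wcompA; congr wcomp; exact: mul_assoc.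
Qed.
Next Obligation.
apply: coinv_inj; rewrite /= -/i !wcompA iM -!wcompA; wmerge.
rewrite i1 !wcomp1.
have -> : eA ⊗ i = (eA ⊗ id1 a) ∘ i.
  rewrite -{2}[i]wten1l; wmerge; by rewrite wcomp1 wcomp1l.
by rewrite wcompA (mul_onel (ca_alg A)) wcomp1l.
Qed.
Next Obligation.
apply: coinv_inj; rewrite /= -/i !wcompA iM -!wcompA; wmerge.
rewrite i1 !wcomp1.
have E : i ⊗ eA = (id1 a ⊗ eA) ∘ (i ⊗ wid [::]) by wmerge; rewrite wcomp1 wcomp1l.
rewrite E wcompA (mul_oner (ca_alg A)) wcomp1l.
exact: (wten1r i erefl erefl).
Qed.

Lemma coinv_algP : is_alg_hom coinv_alg (ca_alg A) coinv_in.
Proof. exact: coinv_in_alg. Qed.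
End Coinvariants.

Section CoequalizerWords.
Variable V : base_category.

Lemma is_coequalizer_heq (C : category) (X Y Q X' Y' Q' : C) (f g : Hom X Y)
  (q : Hom Y Q) (f' g' : Hom X' Y') (q' : Hom Y' Q') :
  heq f f' -> heq g g' -> heq q q' -> is_coequalizer f g q -> is_coequalizer f' g' q'.
Proof.
move=> [eX [eY <-]] [eX1 [eY1 <-]] [eY2 [eQ <-]]; destruct eX, eY, eQ.
by rewrite (Prop_irrelevance eX1 erefl) (Prop_irrelevance eY1 erefl)
  (Prop_irrelevance eY2 erefl).
Qed.

Lemma coeq_wten (u v w : seq V) (Q : V) (f g : whom u v) (q : whom v [:: Q]) :
  is_coequalizer f g q ->
  is_coequalizer (f ⊗ wid w) (g ⊗ wid w) (q ⊗ wid w).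
Proof.
move=> /(tenM_coeqr (prodw w)); apply: is_coequalizer_heq; apply: heq_sym; exact: heq_wten.
Qed.
End CoequalizerWords.

Section TensorOver.
Variables (V : base_category) (B : V) (b : algebra_on B).

Record lmodule := LModule {
  lm_ob : V;
  lm_act : whom [:: B; lm_ob] [:: lm_ob];
  lm_actP : is_lmodule b lm_act }.

Definition ten_over (X : rmodule b) (N : lmodule) : V :=
  coequ_ob (rm_act X ⊗ id1 (lm_ob N)
              : Hom (prodw [:: rm_ob X; B; lm_ob N]) (prodw [:: rm_ob X; lm_ob N]))
           (id1 (rm_ob X) ⊗ lm_act N).

Definition ten_pi (X : rmodule b) (N : lmodule) :
    whom [:: rm_ob X; lm_ob N] [:: ten_over X N] :=
  coequ (rm_act X ⊗ id1 (lm_ob N)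
           : Hom (prodw [:: rm_ob X; B; lm_ob N]) (prodw [:: rm_ob X; lm_ob N]))
        (id1 (rm_ob X) ⊗ lm_act N).

Lemma ten_piP (X : rmodule b) (N : lmodule) :
  is_coequalizer (rm_act X ⊗ id1 (lm_ob N)
              : Hom (prodw [:: rm_ob X; B; lm_ob N]) (prodw [:: rm_ob X; lm_ob N]))
           (id1 (rm_ob X) ⊗ lm_act N) (ten_pi X N).
Proof. exact: coequP. Qed.

Lemma ten_piE (X : rmodule b) (N : lmodule) :
  ten_pi X N ∘ (rm_act X ⊗ id1 (lm_ob N)) = ten_pi X N ∘ (id1 (rm_ob X) ⊗ lm_act N).
Proof. exact: (ten_piP X N).1. Qed.

Lemma ten_pi_wten (X : rmodule b) (N : lmodule) (w : seq V) :
  is_coequalizer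
    ((rm_act X ⊗ id1 (lm_ob N)) ⊗ wid w
       : Hom (prodw (rm_ob X :: B :: lm_ob N :: w)) (prodw (rm_ob X :: lm_ob N :: w)))
    ((id1 (rm_ob X) ⊗ lm_act N) ⊗ wid w) (ten_pi X N ⊗ wid w).
Proof. exact: (coeq_wten w (ten_piP X N)). Qed.

Lemma ten_pi_epi (X : rmodule b) (N : lmodule) (w v : seq V)
  (f g : whom (ten_over X N :: w) v) :
  f ∘ (ten_pi X N ⊗ wid w) = g ∘ (ten_pi X N ⊗ wid w) -> f = g.
Proof. exact: (coeq_epi (ten_pi_wten X N w)). Qed.

Lemma ten_pi_epi1 (X : rmodule b) (N : lmodule) (v : seq V)
  (f g : whom [:: ten_over X N] v) : f ∘ ten_pi X N = g ∘ ten_pi X N -> f = g.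
Proof. exact: (coeq_epi (ten_piP X N)). Qed.

(* [g : N ⊗ w -> N' ⊗ w'] is left B-linear *)
Definition is_llinear (N N' : lmodule) (w w' : seq V)
    (g : whom (lm_ob N :: w) (lm_ob N' :: w')) : Prop :=
  g ∘ (lm_act N ⊗ wid w) = (lm_act N' ⊗ wid w') ∘ (id1 B ⊗ g).

Section Map.
Variables (X : rmodule b) (N N' : lmodule) (w w' : seq V).
Variables (g : whom (lm_ob N :: w) (lm_ob N' :: w')) (gP : is_llinear g).
Let x := rm_ob X.
Let n := lm_ob N.
Let n' := lm_ob N'.

Lemma ten_mapP :
  ((ten_pi X N' ⊗ wid w') ∘ (id1 (rm_ob X) ⊗ g)) ∘ ((rm_act X ⊗ id1 (lm_ob N)) ⊗ wid w)
  = ((ten_pi X N' ⊗ wid w') ∘ (id1 (rm_ob X) ⊗ g)) ∘ ((id1 (rm_ob X) ⊗ lm_act N) ⊗ wid w).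
Proof.
rewrite -!wcompA -/x -/n.
wassoc (rm_act X) (id1 n) (wid w); wassoc (id1 x) (lm_act N) (wid w).
wmerge; wmerge; rewrite !wcomp1l wten1 wcomp1.
move: gP; rewrite /is_llinear => ->.
have -> : rm_act X ⊗ g = (rm_act X ⊗ wid (n' :: w')) ∘ (wid [:: x; B] ⊗ g).
  by wmerge; rewrite wcomp1 wcomp1l.
have -> : wid (n' :: w') = id1 n' ⊗ wid w' by rewrite wten1.
wassocV (rm_act X) (id1 n') (wid w').
rewrite wcompA; wmerge; rewrite ten_piE.
have -> : id1 x ⊗ (lm_act N' ⊗ wid w' ∘ id1 B ⊗ g)
   = (id1 x ⊗ lm_act N' ⊗ wid w') ∘ (wid [:: x; B] ⊗ g).
  have -> : wid [:: x; B] = id1 x ⊗ id1 B by rewrite wten1.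
  wassoc (id1 x) (id1 B) g; wmerge; by rewrite wcomp1.
rewrite wcompA; congr wcomp.
by wassocV (id1 x) (lm_act N') (wid w'); wmerge.
Qed.

(** X ⊗_B g, as a morphism from (X ⊗_B N) ⊗ w to (X ⊗_B N') ⊗ w'; here
  X ⊗_B (N ⊗ w) is identified with (X ⊗_B N) ⊗ w, because the tensor product
  preserves coequalizers. *)
Definition ten_map : whom (ten_over X N :: w) (ten_over X N' :: w') :=
  coeq_desc (ten_pi_wten X N w) ten_mapP.

Lemma ten_mapE : ten_map ∘ (ten_pi X N ⊗ wid w)
  = (ten_pi X N' ⊗ wid w') ∘ (id1 (rm_ob X) ⊗ g).
Proof. exact: coeq_descE. Qed.
End Map.

Section MapLeft.
Variables (X Y : rmodule b) (N : lmodule) (f : whom [:: rm_ob X] [:: rm_ob Y]).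
Variable fP : is_rlinear f.
Let x := rm_ob X.
Let y := rm_ob Y.
Let n := lm_ob N.

Lemma ten_maplP :
  (ten_pi Y N ∘ (f ⊗ id1 (lm_ob N))) ∘ (rm_act X ⊗ id1 (lm_ob N))
  = (ten_pi Y N ∘ (f ⊗ id1 (lm_ob N))) ∘ (id1 (rm_ob X) ⊗ lm_act N).
Proof.
rewrite -!wcompA; wmerge; wmerge.
move: fP; rewrite /is_rlinear !wcomp1 !wcomp1l => ->.
have -> : (rm_act Y ∘ (f ⊗ id1 B)) ⊗ id1 n = (rm_act Y ⊗ id1 n) ∘ ((f ⊗ id1 B) ⊗ id1 n).
  by wmerge; rewrite wcomp1.
rewrite wcompA ten_piE -wcompA; congr wcomp.
wassoc f (id1 B) (id1 n); wmerge.
by rewrite wten1 wcomp1 wcomp1l.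
Qed.

(** f ⊗_B N *)
Definition ten_mapl : whom [:: ten_over X N] [:: ten_over Y N] :=
  coeq_desc (ten_piP X N) ten_maplP.

Lemma ten_maplE : ten_mapl ∘ ten_pi X N = ten_pi Y N ∘ (f ⊗ id1 (lm_ob N)).
Proof. exact: coeq_descE. Qed.
End MapLeft.
End TensorOver.

Section Scalars.
Variables (V : base_category) (A B : V) (a : algebra_on A) (b : algebra_on B).
Variables (i : whom [:: B] [:: A]) (iP : is_alg_hom b a i).
Let m : whom [:: A; A] [:: A] := mul a.
Let e : whom [::] [:: A] := one a.
Let iM : i ∘ mul b = m ∘ (i ⊗ i). Proof. exact: iP.1. Qed.
Let i1 : i ∘ one b = e. Proof. exact: iP.2. Qed.

Lemma restr_lP : is_lmodule b (mul a ∘ (i ⊗ id1 A)).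
Proof.
rewrite /is_lmodule -/m; split.
- rewrite -wcompA; wmerge; rewrite wcomp1 wcomp1l -wcompA; wmerge.
  rewrite wcomp1 iM.
  have -> : i ⊗ (m ∘ i ⊗ id1 A) = (id1 A ⊗ m) ∘ (i ⊗ i ⊗ id1 A) by wmerge; rewrite wcomp1l.
  have -> : (m ∘ i ⊗ i) ⊗ id1 A = (m ⊗ id1 A) ∘ ((i ⊗ i) ⊗ id1 A) by wmerge; rewrite wcomp1.
  by wassoc i i (id1 A); rewrite !wcompA (mul_assoc a).
- rewrite -wcompA; wmerge; rewrite wcomp1 i1; exact: mul_onel.
Qed.

(** A as a left B-module via i *)
Definition restr_l : lmodule b := LModule restr_lP.

Lemma restr_rP (M : rmodule a) : is_rmodule b (rm_act M ∘ (id1 (rm_ob M) ⊗ i)).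
Proof.
case: M => M x [xA x1] /=; rewrite /is_rmodule; split.
- rewrite -!wcompA; wmerge; wmerge; rewrite !wcomp1 !wcomp1l iM.
  have -> : (x ∘ id1 M ⊗ i) ⊗ i = (x ⊗ id1 A) ∘ ((id1 M ⊗ i) ⊗ i) by wmerge; rewrite wcomp1l.
  have -> : id1 M ⊗ (m ∘ i ⊗ i) = (id1 M ⊗ m) ∘ (id1 M ⊗ i ⊗ i) by wmerge; rewrite wcomp1.
  by wassoc (id1 M) i i; rewrite !wcompA xA.
- by rewrite -wcompA; wmerge; rewrite wcomp1 i1.
Qed.

Definition restr_r (M : rmodule a) : rmodule b := RModule (restr_rP M).

Lemma restr_linear (M N : rmodule a) (f : whom [:: rm_ob M] [:: rm_ob N]) :
  is_rlinear f -> is_rlinear (X := restr_r M) (Y := restr_r N) f.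
Proof.
rewrite /is_rlinear /= => fP; rewrite wcompA fP -!wcompA; congr wcomp.
by do 2!wmerge; rewrite !wcomp1 !wcomp1l.
Qed.

Program Definition restriction : functor (rmodules a) (rmodules b) :=
  @Functor (rmodules a) (rmodules b) restr_r
    (fun M N f => exist _ (sval f) (restr_linear (proj2_sig f))) _ _.
Next Obligation. by move=> M; apply: eq_exist. Qed.
Next Obligation. by move=> *; apply: eq_exist. Qed.

Section Ext.
Variable X : rmodule b.
Let x := rm_ob X.
Let T : V := ten_over X restr_l.
Let p : whom [:: x; A] [:: T] := ten_pi X restr_l.

Lemma mul_llinear : @is_llinear _ _ b restr_l restr_l [:: A] [::] (mul a).
Proof.
rewrite /is_llinear /= -/m.
rewrite [X in _ = X ∘ _](wten1r (m ∘ i ⊗ id1 A) erefl erefl) -wcompA; wmerge.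
rewrite wcomp1 wcomp1l.
have -> : i ⊗ m = (id1 A ⊗ m) ∘ (i ⊗ wid [:: A; A]) by wmerge; rewrite wcomp1l wcomp1.
rewrite [RHS]wcompA -(mul_assoc a) -wcompA; congr wcomp.
have -> : wid [:: A; A] = id1 A ⊗ id1 A by rewrite wten1.
wassocV i (id1 A) (id1 A); wmerge; by rewrite wcomp1.
Qed.

(** X ⊗_B m_A *)
Definition ext_act : whom [:: T; A] [:: T] := ten_map X mul_llinear.

Lemma ext_actE : ext_act ∘ (ten_pi X restr_l ⊗ id1 A)
  = ten_pi X restr_l ∘ (id1 (rm_ob X) ⊗ mul a).
Proof.
rewrite /ext_act ten_mapE; congr wcomp.
exact: (wten1r p erefl erefl).
Qed.

Lemma ext_actP : is_rmodule a ext_act.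
Proof.
rewrite /is_rmodule -/m -/e; split.
- apply: (@ten_pi_epi _ _ b X restr_l [:: A; A]).
  rewrite -/T -/p -!wcompA.
  have -> : wid [:: A; A] = id1 A ⊗ id1 A by rewrite wten1.
  wassocV p (id1 A) (id1 A); wmerge.
  rewrite ext_actE -/m -/p -/x.
  wassoc p (id1 A) (id1 A); wmerge; rewrite wten1 !wcomp1 !wcomp1l.
  have -> : (p ∘ id1 x ⊗ m) ⊗ id1 A = (p ⊗ id1 A) ∘ ((id1 x ⊗ m) ⊗ id1 A).
    by wmerge; rewrite wcomp1.
  have -> : p ⊗ m = (p ⊗ id1 A) ∘ (wid [:: x; A] ⊗ m) by wmerge; rewrite wcomp1 wcomp1l.
  rewrite !wcompA ext_actE -/m -/p -/x -!wcompA; congr wcomp.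
  have -> : wid [:: x; A] = id1 x ⊗ id1 A by rewrite wten1.
  wassoc (id1 x) m (id1 A); wassoc (id1 x) (id1 A) m; wmerge; wmerge.
  by rewrite (mul_assoc a).
- apply: ten_pi_epi1; rewrite -/T -/p wcomp1l -wcompA.
  have -> : (id1 T ⊗ e) ∘ p = (p ⊗ id1 A) ∘ (wid [:: x; A] ⊗ e).
    wmerge; rewrite wcomp1 wcomp1l.
    have E : (id1 T ⊗ e) ∘ (p ⊗ wid [::]) = p ⊗ e by wmerge; rewrite wcomp1 wcomp1l.
    rewrite -E; congr wcomp; symmetry; exact: (wten1r p erefl erefl).
  rewrite wcompA ext_actE -/m -/p -/x.
  have -> : wid [:: x; A] = id1 x ⊗ id1 A by rewrite wten1.
  wassoc (id1 x) (id1 A) e; rewrite -wcompA; wmerge.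
  rewrite (mul_oner a) wcomp1 wten1; exact: wcomp1.
Qed.

Definition ext_ob : rmodule a := RModule ext_actP.
End Ext.

Lemma ext_linear (X Y : rmodule b) (f : whom [:: rm_ob X] [:: rm_ob Y]) (fP : is_rlinear f) :
  is_rlinear (X := ext_ob X) (Y := ext_ob Y) (ten_mapl restr_l fP).
Proof.
rewrite /is_rlinear /=; apply: (@ten_pi_epi _ _ b X restr_l [:: A]).
rewrite -!wcompA ext_actE (wcompA _ (ten_pi X restr_l)) (ten_maplE restr_l fP); wmerge.
rewrite (ten_maplE restr_l fP) wcomp1.
have -> : (ten_pi Y restr_l ∘ f ⊗ id1 (lm_ob restr_l)) ⊗ id1 A
  = (ten_pi Y restr_l ⊗ id1 A) ∘ ((f ⊗ id1 A) ⊗ id1 A) by wmerge; rewrite wcomp1.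
rewrite wcompA ext_actE -!wcompA; congr wcomp.
wassoc f (id1 A) (id1 A); wmerge; wmerge.
by rewrite wten1 !wcomp1 !wcomp1l.
Qed.

Program Definition extension : functor (rmodules b) (rmodules a) :=
  @Functor (rmodules b) (rmodules a) ext_ob
    (fun X Y f => exist _ (ten_mapl restr_l (proj2_sig f)) (ext_linear (proj2_sig f))) _ _.
Next Obligation.
move=> X; apply: eq_exist; apply: ten_pi_epi1; rewrite ten_maplE /= wten1.
by rewrite wcomp1 wcomp1l.
Qed.
Next Obligation.
move=> X Y Z [g gP] [f fP]; apply: eq_exist; apply: ten_pi_epi1; rewrite ten_maplE /=.
rewrite -[RHS]wcompA (ten_maplE restr_l fP) (wcompA _ (ten_pi Y restr_l)).
by rewrite (ten_maplE restr_l gP) -wcompA; wmerge; rewrite wcomp1.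
Qed.

Section Unit.
Variable X : rmodule b.
Let x := rm_ob X.
Let p : whom [:: x; A] [:: ten_over X restr_l] := ten_pi X restr_l.

Definition scal_unit : whom [:: rm_ob X] [:: rm_ob (ext_ob X)] :=
  ten_pi X restr_l ∘ (id1 (rm_ob X) ⊗ one a).

Lemma scal_unit_linear : is_rlinear (X := X) (Y := restr_r (ext_ob X)) scal_unit.
Proof.
rewrite /is_rlinear /= /scal_unit -/m -/e -/p -/x -!wcompA.
wmerge; rewrite wcomp1 wcomp1l.
have -> : (p ∘ id1 x ⊗ e) ⊗ i = (p ⊗ id1 A) ∘ ((id1 x ⊗ e) ⊗ i) by wmerge; rewrite wcomp1l.
rewrite (wcompA _ (p ⊗ id1 A)) (ext_actE X) -/m -/p -/x -wcompA.
have -> : (id1 x ⊗ e) ∘ rm_act X = (rm_act X ⊗ id1 A) ∘ (wid [:: x; B] ⊗ e).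
  wmerge; rewrite wcomp1 wcomp1l.
  have E : (id1 x ⊗ e) ∘ (rm_act X ⊗ wid [::]) = rm_act X ⊗ e.
    by wmerge; rewrite wcomp1 wcomp1l.
  rewrite -E; congr wcomp; symmetry; exact: (wten1r (rm_act X) erefl erefl).
rewrite (wcompA p (rm_act X ⊗ id1 A)) (ten_piE X restr_l) /= -wcompA; congr wcomp.
have -> : wid [:: x; B] = id1 x ⊗ id1 B by rewrite wten1.
wassoc (id1 x) (id1 B) e; wassoc (id1 x) e i; wmerge; wmerge.
suff -> : (mul a ∘ (i ⊗ id1 A)) ∘ (id1 B ⊗ e) = m ∘ (e ⊗ i) by [].
rewrite -wcompA; wmerge; rewrite wcomp1 wcomp1l.
have -> : i ⊗ e = (id1 A ⊗ e) ∘ i.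
  have E : (id1 A ⊗ e) ∘ (i ⊗ wid [::]) = i ⊗ e by wmerge; rewrite wcomp1 wcomp1l.
  rewrite -E; congr wcomp; exact: (wten1r i erefl erefl).
have -> : e ⊗ i = (e ⊗ id1 A) ∘ i.
  by rewrite -{2}[i]wten1l; wmerge; rewrite wcomp1 wcomp1l.
by rewrite !wcompA (mul_onel a) (mul_oner a).
Qed.
End Unit.

Section Counit.
Variable M : rmodule a.
Let x := rm_ob M.

Lemma scal_counitP :
  rm_act M ∘ (rm_act (restr_r M) ⊗ id1 (lm_ob restr_l))
  = rm_act M ∘ (id1 (rm_ob (restr_r M)) ⊗ lm_act restr_l).
Proof.
rewrite /= -/x -/m.
have -> : (rm_act M ∘ id1 x ⊗ i) ⊗ id1 A = (rm_act M ⊗ id1 A) ∘ ((id1 x ⊗ i) ⊗ id1 A).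
  by wmerge; rewrite wcomp1.
rewrite wcompA (rm_actP M).1 -wcompA; congr wcomp.
by wassoc (id1 x) i (id1 A); wmerge; rewrite wcomp1.
Qed.

(** The morphism X ⊗_B A -> X induced by the action of A *)
Definition scal_counit : whom [:: rm_ob (ext_ob (restr_r M))] [:: rm_ob M] :=
  coeq_desc (ten_piP (restr_r M) restr_l) scal_counitP.

Lemma scal_counitE : scal_counit ∘ ten_pi (restr_r M) restr_l = rm_act M.
Proof. exact: coeq_descE. Qed.

Lemma scal_counit_linear : is_rlinear (X := ext_ob (restr_r M)) (Y := M) scal_counit.
Proof.
rewrite /is_rlinear; apply: (@ten_pi_epi _ _ b (restr_r M) restr_l [:: A]).
rewrite -!wcompA ext_actE (wcompA _ (ten_pi (restr_r M) restr_l)) scal_counitE; wmerge.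
by rewrite scal_counitE wcomp1 (rm_actP M).1.
Qed.
End Counit.

Program Definition scal_unit_nat : nat_trans (id_functor (rmodules b))
    (comp_functor restriction extension) :=
  @NatTrans _ _ (id_functor (rmodules b)) (comp_functor restriction extension)
    (fun X => exist _ (scal_unit X) (scal_unit_linear X)) _.
Next Obligation.
move=> X Y [f fP]; apply: eq_exist; rewrite /= /scal_unit -wcompA.
rewrite (wcompA _ (ten_pi X restr_l)) (ten_maplE restr_l fP) -wcompA.
congr wcomp; wmerge; rewrite wcomp1l wcomp1 -/e.
have E : (id1 (rm_ob Y) ⊗ e) ∘ (f ⊗ wid [::]) = f ⊗ e by wmerge; rewrite wcomp1 wcomp1l.
rewrite -E; congr wcomp; symmetry; exact: (wten1r f erefl erefl).
Qed.

Program Definition scal_counit_nat : nat_trans (comp_functor extension restriction)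
    (id_functor (rmodules a)) :=
  @NatTrans _ _ (comp_functor extension restriction) (id_functor (rmodules a))
    (fun M => exist _ (scal_counit M) (scal_counit_linear M)) _.
Next Obligation.
move=> M N [f fP]; apply: eq_exist; apply: (@ten_pi_epi1 _ _ b (restr_r M) restr_l).
rewrite /= -!wcompA (ten_maplE restr_l (restr_linear fP)) (wcompA _ (ten_pi (restr_r N) restr_l)) !scal_counitE; symmetry; exact: fP.
Qed.

Program Definition scalars_adjunction : adjunction extension restriction :=
  @Adjunction _ _ extension restriction scal_unit_nat scal_counit_nat _ _.
Next Obligation.
move=> X; apply: eq_exist; apply: (@ten_pi_epi1 _ _ b X restr_l).
rewrite /= -wcompA (ten_maplE restr_l (scal_unit_linear X)) (wcompA _ (ten_pi (restr_r (ext_ob X)) restr_l)) (scal_counitE (ext_ob X)) /=.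
rewrite /scal_unit -/e wcomp1l.
have -> : (ten_pi X restr_l ∘ id1 (rm_ob X) ⊗ e) ⊗ id1 A
  = (ten_pi X restr_l ⊗ id1 A) ∘ ((id1 (rm_ob X) ⊗ e) ⊗ id1 A) by wmerge; rewrite wcomp1.
rewrite wcompA ext_actE -wcompA; wassoc (id1 (rm_ob X)) e (id1 A); wmerge.
rewrite (mul_onel a) wcomp1 wten1; exact: wcomp1.
Qed.
Next Obligation.
move=> M; apply: eq_exist; rewrite /= /scal_unit wcompA (scal_counitE M).
exact: (rm_actP M).2.
Qed.
End Scalars.

Section Galois.
Variables (V : base_category) (H : bialgebra V) (A : comodule_algebra H).
Let h : V := bi_ob H.
Let a : V := ca_ob A.
Let i : whom [:: coinv A] [:: a] := coinv_in A.
Let m : whom [:: a; a] [:: a] := mul (ca_alg A).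
Let mH : whom [:: h; h] [:: h] := mul (bi_alg H).
Let eH : whom [::] [:: h] := one (bi_alg H).
Let al : whom [:: a] [:: a; h] := ca_coact A.

(** A as a left module over its coinvariants *)
Definition coinv_l : lmodule (coinv_alg A) := restr_l (coinv_algP A).

Definition entwined : category :=
  emodules (ca_alg A) (bi_coalg H) (entwining A).

Lemma coact_mul : al ∘ m = (m ⊗ mH) ∘ (id1 a ⊗ braid h a ⊗ id1 h) ∘ (al ⊗ al).
Proof. by rewrite [LHS](ca_coact_alg A).1 /= wcompA. Qed.

Lemma coact_mul_entwining :
  al ∘ m = (m ⊗ id1 h) ∘ (id1 a ⊗ entwining A) ∘ (al ⊗ id1 a).
Proof.
rewrite coact_mul entwiningE -/a -/h -/al -/mH.
have -> : al ⊗ al = (wid [:: a; h] ⊗ al) ∘ (al ⊗ id1 a).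
  by wmerge; rewrite wcomp1 wcomp1l.
rewrite !wcompA; congr wcomp.
have -> : wid [:: a; h] = id1 a ⊗ id1 h by rewrite wten1.
wassoc (id1 a) (id1 h) al; rewrite -!wcompA; wmerge; rewrite wcomp1l.
set k := _ ∘ (id1 h ⊗ al).
have -> : m ⊗ mH = (m ⊗ id1 h) ∘ ((id1 a ⊗ id1 a) ⊗ mH).
  by wmerge; rewrite wten1 wcomp1 wcomp1l.
rewrite -wcompA; congr wcomp.
wassoc (id1 a) (id1 a) mH; wmerge; by rewrite wcomp1l.
Qed.

Lemma coact_coinvl : al ∘ (m ∘ (i ⊗ id1 a)) = (m ⊗ id1 h) ∘ (i ⊗ al).
Proof.
rewrite wcompA coact_mul -!wcompA; wmerge; rewrite wcomp1.
rewrite [X in X ⊗ al](coinv_inE A) -/a -/i -/eH.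
have -> : ((id1 a ⊗ eH) ∘ i) ⊗ al = ((id1 a ⊗ eH) ⊗ wid [:: a; h]) ∘ (i ⊗ al).
  by wmerge; rewrite wcomp1l.
have -> : wid [:: a; h] = id1 a ⊗ id1 h by rewrite wten1.
rewrite (wcompA (id1 a ⊗ braid h a ⊗ id1 h)).
wassoc (id1 a) eH (id1 a ⊗ id1 h); wassocV eH (id1 a) (id1 h).
have -> : (id1 a ⊗ braid h a ⊗ id1 h) ∘ (id1 a ⊗ (eH ⊗ id1 a) ⊗ id1 h)
  = id1 a ⊗ (id1 a ⊗ eH) ⊗ id1 h by do 2!wmerge; rewrite !wcomp1 braid_unitl.
wassoc (id1 a) eH (id1 h); wassocV (id1 a) (id1 a) (eH ⊗ id1 h).
rewrite wcompA; wmerge; rewrite wten1 wcomp1.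
by rewrite (mul_onel (bi_alg H)).
Qed.

Lemma coact_llinear : @is_llinear _ _ (coinv_alg A) coinv_l coinv_l [::] [:: h] (ca_coact A).
Proof.
rewrite /is_llinear /= -/m -/i -/a -/h -/al.
have E : (m ∘ (i ⊗ id1 a)) ⊗ wid [::] = m ∘ (i ⊗ id1 a).
  exact: (wten1r (m ∘ (i ⊗ id1 a)) erefl erefl).
rewrite [X in _ ∘ X = _]E coact_coinvl.
have -> : (m ∘ (i ⊗ id1 a)) ⊗ id1 h = (m ⊗ id1 h) ∘ ((i ⊗ id1 a) ⊗ id1 h).
  by wmerge; rewrite wcomp1.
rewrite -wcompA; congr wcomp.
wassoc i (id1 a) (id1 h); wmerge; by rewrite wten1 wcomp1 wcomp1l.
Qed.

Section FbarOb.
Variable X : rmodule (coinv_alg A).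
Let x := rm_ob X.
Let T : V := ten_over X coinv_l.
Let p : whom [:: x; a] [:: T] := ten_pi X coinv_l.

(** X ⊗_B α_A, for B the algebra of coinvariants *)
Definition fbar_coact : whom [:: ten_over X coinv_l] [:: ten_over X coinv_l; bi_ob H] :=
  ten_map X coact_llinear.

Lemma fbar_coactE : fbar_coact ∘ ten_pi X coinv_l
  = (ten_pi X coinv_l ⊗ id1 (bi_ob H)) ∘ (id1 (rm_ob X) ⊗ ca_coact A).
Proof.
apply: etrans (ten_mapE X coact_llinear); congr wcomp; symmetry.
exact: (wten1r p erefl erefl).
Qed.

Lemma fbar_coactP : is_rcomodule (bi_coalg H) fbar_coact.
Proof.
have [alA al1] := ca_coactP A; split; apply: ten_pi_epi1.
- rewrite -!wcompA fbar_coactE -/p -/x -/al -/h.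
  have -> : (id1 T ⊗ comult (bi_coalg H)) ∘ ((p ⊗ id1 h) ∘ (id1 x ⊗ al))
     = (p ⊗ id1 h ⊗ id1 h) ∘ (id1 x ⊗ ((id1 a ⊗ comult (bi_coalg H)) ∘ al)).
    rewrite wcompA; wmerge; rewrite wcomp1l wcomp1.
    have -> : p ⊗ comult (bi_coalg H)
      = (p ⊗ id1 h ⊗ id1 h) ∘ ((id1 x ⊗ id1 a) ⊗ comult (bi_coalg H)).
      by wmerge; rewrite !wten1 wcomp1 wcomp1l.
    rewrite -wcompA; congr wcomp; wassoc (id1 x) (id1 a) (comult (bi_coalg H)); wmerge.
    by rewrite wcomp1.
  rewrite wcompA; wmerge; rewrite fbar_coactE -/p -/x -/al -/h wcomp1.
  have -> : ((p ⊗ id1 h) ∘ (id1 x ⊗ al)) ⊗ id1 h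
    = ((p ⊗ id1 h) ⊗ id1 h) ∘ ((id1 x ⊗ al) ⊗ id1 h) by wmerge; rewrite wcomp1.
  wassoc p (id1 h) (id1 h); wassoc (id1 x) al (id1 h).
  rewrite -wcompA; congr wcomp; wmerge; rewrite wcomp1.
  by rewrite [in LHS]alA.
- rewrite -wcompA fbar_coactE -/p -/x -/al -/h wcompA; wmerge; rewrite wcomp1l wcomp1.
  have -> : p ⊗ counit (bi_coalg H) = p ∘ ((id1 x ⊗ id1 a) ⊗ counit (bi_coalg H)).
    have E : p ⊗ wid [::] = p by exact: (wten1r p erefl erefl).
    by rewrite -{2}E; wmerge; rewrite wten1 wcomp1 wcomp1l.
  wassoc (id1 x) (id1 a) (counit (bi_coalg H)); rewrite -wcompA; wmerge.
  by rewrite [in LHS]al1 !wcomp1 wten1 ?wcomp1 ?wcomp1l.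
Qed.

Lemma fbar_compat : fbar_coact ∘ ext_act (coinv_algP A) X
  = (ext_act (coinv_algP A) X ⊗ id1 (bi_ob H))
      ∘ (id1 (ten_over X coinv_l) ⊗ entwining A) ∘ (fbar_coact ⊗ id1 (ca_ob A)).
Proof.
apply: (@ten_pi_epi _ _ (coinv_alg A) X coinv_l [:: a]).
have actE := ext_actE (coinv_algP A) X.
rewrite -/coinv_l -/m -/p -/x -/a in actE.
rewrite -!wcompA actE (wcompA _ p) fbar_coactE -/p -/x -/al -/h -/a -/T -wcompA.
wmerge; rewrite [al ∘ m]coact_mul_entwining.
wmerge; rewrite fbar_coactE -/p -/x -/al -/h !wcomp1.
have -> : ((p ⊗ id1 h) ∘ (id1 x ⊗ al)) ⊗ id1 a
   = (p ⊗ id1 h ⊗ id1 a) ∘ (id1 x ⊗ al ⊗ id1 a).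
  wassocV p (id1 h) (id1 a); wassocV (id1 x) al (id1 a); by wmerge; rewrite wcomp1.
rewrite (wcompA (id1 T ⊗ entwining A)); wmerge; rewrite wten1 wcomp1l wcomp1.
have -> : p ⊗ entwining A = (p ⊗ id1 a ⊗ id1 h) ∘ ((id1 x ⊗ id1 a) ⊗ entwining A).
  by wmerge; rewrite !wten1 wcomp1 wcomp1l.
wassoc (id1 x) (id1 a) (entwining A); rewrite -!wcompA.
wassocV p (id1 a) (id1 h).
rewrite (wcompA (ext_act _ _ ⊗ id1 h)); wmerge; rewrite actE wcomp1.
have -> : (p ∘ (id1 x ⊗ m)) ⊗ id1 h = (p ⊗ id1 h) ∘ (id1 x ⊗ m ⊗ id1 h).
  by wassocV (id1 x) m (id1 h); wmerge; rewrite wcomp1.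
rewrite -!wcompA; congr wcomp.
by do 2!wmerge; rewrite !wcomp1.
Qed.

Definition fbar_ob : emodule (ca_alg A) (bi_coalg H) (entwining A) :=
  @EModule _ _ _ _ _ _ (ext_ob (coinv_algP A) X) fbar_coact fbar_coactP fbar_compat.
End FbarOb.

Lemma fbar_colinear (X Y : rmodule (coinv_alg A))
  (f : whom [:: rm_ob X] [:: rm_ob Y]) (fP : is_rlinear f) :
  is_colinear (X := fbar_ob X) (Y := fbar_ob Y) (ten_mapl coinv_l fP).
Proof.
rewrite /is_colinear /=; apply: ten_pi_epi1.
rewrite -!wcompA (ten_maplE coinv_l fP) (wcompA _ (ten_pi Y coinv_l)) !fbar_coactE.
rewrite -wcompA (wcompA _ (ten_pi X coinv_l ⊗ id1 (bi_ob H))).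
wmerge; wmerge; rewrite (ten_maplE coinv_l fP) !wcomp1 !wcomp1l.
have -> : (ten_pi Y coinv_l ∘ (f ⊗ id1 a)) ⊗ id1 h
  = (ten_pi Y coinv_l ⊗ id1 h) ∘ (f ⊗ id1 a ⊗ id1 h).
  by wassocV f (id1 a) (id1 h); wmerge; rewrite wcomp1.
rewrite -wcompA; congr wcomp; wmerge.
by rewrite wten1 wcomp1 wcomp1l.
Qed.

Program Definition fbar : functor (rmodules (coinv_alg A)) entwined :=
  @Functor (rmodules (coinv_alg A)) entwined fbar_ob
    (fun X Y f => exist _ (ten_mapl coinv_l (proj2_sig f))
       (conj (ext_linear (coinv_algP A) (proj2_sig f)) (fbar_colinear (proj2_sig f)))) _ _.
Next Obligation.
move=> X; apply: eq_exist; exact: (congr1 sval (fmap1 (extension (coinv_algP A)) X)).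
Qed.
Next Obligation.
move=> X Y Z g f; apply: eq_exist.
exact: (congr1 sval (fmapM (extension (coinv_algP A)) g f)).
Qed.

(** A as a right module over its coinvariants *)
Lemma reg_rP : is_rmodule (ca_alg A) (mul (ca_alg A)).
Proof. by split; [apply: mul_assoc | apply: mul_oner]. Qed.

Definition coinv_r : rmodule (coinv_alg A) :=
  restr_r (coinv_algP A) (RModule reg_rP).

Lemma canP :
  ((mul (ca_alg A) ⊗ id1 (bi_ob H)) ∘ (id1 (ca_ob A) ⊗ ca_coact A))
    ∘ (rm_act coinv_r ⊗ id1 (lm_ob coinv_l))
  = ((mul (ca_alg A) ⊗ id1 (bi_ob H)) ∘ (id1 (ca_ob A) ⊗ ca_coact A))
    ∘ (id1 (rm_ob coinv_r) ⊗ lm_act coinv_l).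
Proof.
rewrite /= -/m -/i -/a -/h -/al -!wcompA.
wmerge; wmerge; rewrite coact_coinvl !wcomp1 !wcomp1l.
have -> : (m ∘ (id1 a ⊗ i)) ⊗ al = (m ⊗ id1 a ⊗ id1 h) ∘ ((id1 a ⊗ i) ⊗ al).
  by wmerge; rewrite wten1 wcomp1l.
have -> : id1 a ⊗ ((m ⊗ id1 h) ∘ (i ⊗ al)) = (id1 a ⊗ m ⊗ id1 h) ∘ (id1 a ⊗ i ⊗ al).
  by wmerge; rewrite wcomp1.
wassoc (id1 a) i al; rewrite !wcompA; congr wcomp.
wassocV m (id1 a) (id1 h); wassocV (id1 a) m (id1 h); wmerge; wmerge.
by rewrite (mul_assoc (ca_alg A)).
Qed.

Definition can : whom [:: ten_over coinv_r coinv_l] [:: ca_ob A; bi_ob H] :=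
  coeq_desc (ten_piP coinv_r coinv_l) canP.

Definition is_Galois : Prop := is_iso can.
End Galois.

(* Main.v *)
Require Import Defs.
From mathcomp Require Import ssreflect ssrfun ssrbool seq.
From mathcomp.classical Require Import boolp.

(** Let B be the algebra of coinvariants of A, and let T be the comonad
  M |-> M ⊗_B A on right A-modules given by extension and restriction of scalars
  along B -> A. Entwined modules are the coalgebras over a second comonad on
  right A-modules, M |-> M ⊗ H, and the morphisms
    [can_at M] : M ⊗_B A -> M ⊗ H,   x ⊗ b |-> x b_0 ⊗ b_1,
  form a morphism of comonads from T to it ([can_at_linear], [can_at_natural],
  [can_at_counit], [can_at_colinear]), whose value at A is can. Composing the
  structure map of a T-coalgebra with [can_at] gives a functor [push] from
  T-coalgebras to entwined modules, and the comparison functor of the adjunction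
  followed by [push] is the functor of the theorem ([push_comparison]).

  If all the [can_at M] are invertible, [push] is an equivalence
  ([push_equivalence]); then the functor of the theorem is an equivalence exactly
  when the comparison functor is, that is, when extension of scalars is comonadic
  ([equivalence_left_factor]). It suffices that can be invertible: the inverse of
  [can_at M] sends x ⊗ h to the action of x on the inverse image of 1 ⊗ h under
  can ([Galois_can_at_iso]).

  So it remains to see that A is Galois when the functor of the theorem is an
  equivalence. The object M ⊗ H is the cofree entwined module on M, so that
  entwined morphisms from X ⊗_B A to it are the A-linear morphisms X ⊗_B A -> M,
  which are the B-linear morphisms X -> M. This says that [can_at M] is a
  universal arrow from the functor of the theorem to M ⊗ H
  ([can_cofree_universal]), and for a full and essentially surjective functor
  universal arrows are isomorphisms ([universal_arrow_iso]). For M = A this is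
  the invertibility of can. *)

Set Implicit Arguments.
Unset Strict Implicit.
Unset Printing Implicit Defensive.
Local Open Scope cat_scope.
Local Obligation Tactic := cbn beta.

(** * Equivalences of categories *)

Section Isos.
Variable C : category.

Lemma is_iso_idm (X : C) : is_iso (idm X).
Proof. by exists (idm X); rewrite compm1. Qed.

Lemma is_iso_comp (X Y Z : C) (g : Hom Y Z) (f : Hom X Y) :
  is_iso g -> is_iso f -> is_iso (compm g f).
Proof.
move=> [g' [gK gK']] [f' [fK fK']]; exists (compm f' g'); split.
- by rewrite -compmA (compmA g') gK comp1m.
- by rewrite -compmA (compmA f) fK' comp1m.
Qed.

Lemma is_iso_inv (X Y : C) (f : Hom X Y) :
  is_iso f -> exists g : Hom Y X, [/\ compm g f = idm X, compm f g = idm Y & is_iso g].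
Proof. by move=> [g [gf fg]]; exists g; split=> //; exists f. Qed.

Lemma is_iso_mono (X Y Z : C) (f : Hom Y Z) (g h : Hom X Y) :
  is_iso f -> compm f g = compm f h -> g = h.
Proof.
by move=> [f' [fK _]] /(congr1 (compm f')); rewrite !compmA fK !comp1m.
Qed.

Lemma is_iso_epi (X Y Z : C) (f : Hom X Y) (g h : Hom Y Z) :
  is_iso f -> compm g f = compm h f -> g = h.
Proof.
by move=> [f' [_ fK]] /(congr1 (compm^~ f')); rewrite -!compmA fK !compm1.
Qed.
End Isos.

Lemma is_iso_fmap (C D : category) (F : functor C D) (X Y : C) (f : Hom X Y) :
  is_iso f -> is_iso (fmap F f).
Proof. by move=> [g [gf fg]]; exists (fmap F g); rewrite -!fmapM gf fg !fmap1. Qed.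

Section Equivalences.
Variables (C D : category) (F : functor C D).

Definition full : Prop :=
  forall (X Y : C) (g : Hom (F X) (F Y)), exists f : Hom X Y, fmap F f = g.
Definition faithful : Prop :=
  forall (X Y : C) (f g : Hom X Y), fmap F f = fmap F g -> f = g.
Definition ess_surjective : Prop :=
  forall Y : D, exists (X : C) (s : Hom (F X) Y), is_iso s.

(** Up to the natural isomorphism, a morphism f is recovered from G (F f). *)
Lemma faithful_retract (G : functor D C) :
  nat_isomorphic (comp_functor G F) (id_functor C) -> faithful.
Proof.
move=> [t tiso] X Y f g fg; apply: (is_iso_epi (tiso X)).
by have := ntP t f; have := ntP t g; rewrite /= fg => -> ->.
Qed.
End Equivalences.

Section EquivalenceCriterion.
Variables (C D : category) (F : functor C D).

Lemma equivalence_full_faithful_ess :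
  is_equivalence F -> [/\ full F, faithful F & ess_surjective F].
Proof.
move=> [G [GF FG]]; have Ff := faithful_retract GF.
have Gf := faithful_retract FG; move: GF FG => [t tiso] [s siso]; split=> //.
- move=> X Y g; have [t' [tK tK' _]] := is_iso_inv (tiso X).
  exists (compm (t Y) (compm (fmap G g) t')); apply: Gf.
  apply: (is_iso_mono (tiso Y)); rewrite (ntP t) /=.
  by rewrite -!compmA tK compm1.
- by move=> Y; exists (G Y), (s Y); apply: siso.
Qed.

Section Inverse.
Hypotheses (Ffull : full F) (Ff : faithful F) (Fes : ess_surjective F).

Let inv_ob (Y : D) : C := sval (cid (Fes Y)).
Let inv_sec (Y : D) : Hom (F (inv_ob Y)) Y := sval (cid (proj2_sig (cid (Fes Y)))).
Let inv_secP (Y : D) : is_iso (inv_sec Y) := proj2_sig (cid (proj2_sig (cid (Fes Y)))).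

(** A quasi-inverse sends g to the preimage under F of g conjugated by the chosen
  isomorphisms [inv_sec]; fullness provides it, faithfulness makes it functorial. *)
Lemma quasi_inverse_subproof (Y Z : D) (g : Hom Y Z) :
  exists f : Hom (inv_ob Y) (inv_ob Z), compm (inv_sec Z) (fmap F f) = compm g (inv_sec Y).
Proof.
have [s' [sK sK' _]] := is_iso_inv (inv_secP Z).
have [f fE] := Ffull (compm s' (compm g (inv_sec Y))).
by exists f; rewrite fE compmA sK' comp1m.
Qed.

Let inv_map (Y Z : D) (g : Hom Y Z) := sval (cid (quasi_inverse_subproof g)).
Let inv_mapE (Y Z : D) (g : Hom Y Z) :
  compm (inv_sec Z) (fmap F (inv_map g)) = compm g (inv_sec Y).
Proof. exact: proj2_sig (cid (quasi_inverse_subproof g)). Qed.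

Lemma full_faithful_ess_equivalence : is_equivalence F.
Proof.
have m1 Y : inv_map (idm Y) = idm (inv_ob Y).
  by apply/Ff/(is_iso_mono (inv_secP Y)); rewrite inv_mapE fmap1 compm1 comp1m.
have mM X Y Z (g : Hom Y Z) (f : Hom X Y) :
    inv_map (compm g f) = compm (inv_map g) (inv_map f).
  apply/Ff/(is_iso_mono (inv_secP Z)).
  by rewrite inv_mapE fmapM compmA inv_mapE -!compmA inv_mapE.
pose G := Functor m1 mM.
have sN Y Z (g : Hom Y Z) : compm (inv_sec Z) (fmap (comp_functor F G) g)
    = compm (fmap (id_functor D) g) (inv_sec Y) by exact: inv_mapE.
have uP X : exists f : Hom (inv_ob (F X)) X, fmap F f = inv_sec (F X) by exact: Ffull.
pose u X := sval (cid (uP X)).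
have uE X : fmap F (u X) = inv_sec (F X) := proj2_sig (cid (uP X)).
have uN X Y (f : Hom X Y) : compm (u Y) (fmap (comp_functor G F) f)
    = compm (fmap (id_functor C) f) (u X).
  by apply: Ff; rewrite !fmapM !uE; exact: inv_mapE.
exists G; split.
- exists (@NatTrans _ _ (comp_functor G F) (id_functor C) u uN) => X /=; have [s' [sK sK' _]] := is_iso_inv (inv_secP (F X)).
  have [v vE] := Ffull s'; exists v.
  by split; apply: Ff; rewrite fmapM uE vE fmap1.
- by exists (@NatTrans _ _ (comp_functor F G) (id_functor D) inv_sec sN) => Y; apply: inv_secP.
Qed.
End Inverse.
End EquivalenceCriterion.

(** Fullness, faithfulness and essential surjectivity can be transported both ways
  along P, because P is bijective on morphisms and, up to isomorphism, surjective
  on objects. *)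
Lemma equivalence_left_factor (C D E : category) (P : functor D E) (K : functor C D)
    (F : functor C E) :
  is_equivalence P -> nat_isomorphic (comp_functor P K) F ->
  is_equivalence F <-> is_equivalence K.
Proof.
move=> /equivalence_full_faithful_ess[Pfull Pf Pes] [t tiso].
split=> /equivalence_full_faithful_ess[fu fa es]; apply: full_faithful_ess_equivalence.
- move=> X Y g; have [t' [tK tK' _]] := is_iso_inv (tiso X).
  have [f fE] := fu _ _ (compm (t Y) (compm (fmap P g) t')).
  exists f; apply/Pf/(is_iso_mono (tiso Y)).
  by rewrite (ntP t f) fE -!compmA tK compm1.
- move=> X Y f g fg; apply: fa; apply: (is_iso_epi (tiso X)).
  by rewrite -(ntP t f) -(ntP t g) /= fg.
- move=> Z; have [X [s siso]] := es (P Z).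
  have [r [rK rK' _]] := is_iso_inv (is_iso_comp siso (tiso X)).
  have [f fE] := Pfull _ _ (compm s (t X)); have [g gE] := Pfull _ _ r.
  by exists X, f, g; split; apply: Pf; rewrite fmapM fE gE fmap1.
- move=> X Y g; have [t' [tK tK' _]] := is_iso_inv (tiso Y).
  have [k kE] := Pfull _ _ (compm t' (compm g (t X))); have [f fE] := fu _ _ k.
  exists f; apply: (is_iso_epi (tiso X)).
  by rewrite -(ntP t f) /= fE kE (compmA (t Y)) tK' comp1m.
- move=> X Y f g fg; apply/fa/Pf/(is_iso_mono (tiso Y)).
  by have := ntP t f; have := ntP t g; rewrite /= fg => -> ->.
- move=> Z; have [Y [s siso]] := Pes Z; have [X [r riso]] := es Y.
  have [t' [_ _ tiso']] := is_iso_inv (tiso X).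
  exists X, (compm s (compm (fmap P r) t')).
  by do 2![apply: is_iso_comp => //]; apply: is_iso_fmap.
Qed.

(** * Universal arrows *)

Section UniversalArrows.
Variables (C D : category) (F : functor C D).

Definition universal_arrow (U : C) (Z : D) (c : Hom (F U) Z) : Prop :=
  forall (X : C) (r : Hom (F X) Z), exists! u : Hom X U, compm c (fmap F u) = r.

(** Essential surjectivity gives an isomorphism s : F X -> Z, which factors through
  c, so c has a right inverse k. Fullness lifts the endomorphism k ∘ c of F U to
  an endomorphism u of U with c ∘ F u = c, and uniqueness gives u = id. *)
Lemma universal_arrow_iso (U : C) (Z : D) (c : Hom (F U) Z) :
  full F -> ess_surjective F -> universal_arrow c -> is_iso c.
Proof.
move=> Ffull Fes cU; have [X [s siso]] := Fes Z.
have [r [rK rK' _]] := is_iso_inv siso.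
have [g [gE _]] := cU X s.
have cr : compm c (compm (fmap F g) r) = idm Z by rewrite compmA gE.
exists (compm (fmap F g) r); split=> //.
have [u uE] := Ffull _ _ (compm (compm (fmap F g) r) c).
have [v [_ vU]] := cU U c.
rewrite -uE -(vU u); last by rewrite uE compmA cr comp1m.
by rewrite (vU (idm U)) fmap1 // compm1.
Qed.

Lemma counit_universal (G : functor D C) (adj : adjunction F G) (Z : D) :
  universal_arrow (adj_counit adj Z).
Proof.
move=> X r; exists (compm (fmap G r) (adj_unit adj X)); split.
- rewrite fmapM compmA.
  have := ntP (adj_counit adj) r; rewrite /= => ->.
  by rewrite -compmA adj_triangleF compm1.
- move=> u <-; rewrite fmapM -compmA.
  have := ntP (adj_unit adj) u; rewrite /= => <-.
  by rewrite compmA adj_triangleG comp1m.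
Qed.
End UniversalArrows.

(** * Normal forms for string diagrams *)

Section Interchange.
Variable V : strict_monoidal.
Implicit Types u v w : seq V.

Lemma wten_lr u v u' v' (f : whom u v) (g : whom u' v') :
  f ⊗ g = (f ⊗ wid v') ∘ (wid u ⊗ g).
Proof. by rewrite -wtenM wcomp1 wcomp1l. Qed.

Lemma wtenMl u v w z (g : whom v w) (f : whom u v) :
  (g ∘ f) ⊗ wid z = (g ⊗ wid z) ∘ (f ⊗ wid z).
Proof. by rewrite -wtenM wcomp1. Qed.

Lemma wtenMr u v w z (g : whom v w) (f : whom u v) :
  wid z ⊗ (g ∘ f) = (wid z ⊗ g) ∘ (wid z ⊗ f).
Proof. by rewrite -wtenM wcomp1. Qed.
End Interchange.

Section Layers.
Variable V : strict_monoidal.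
Implicit Types u v w x y : seq V.

(** A layer of a string diagram: a single box f, with the strings of u to its left
  and those of v to its right. Both words are kept even when they are empty, so
  that every diagram becomes a composite of terms of one shape. *)
Definition lay u x y (f : whom x y) v : whom (u ++ x ++ v) (u ++ y ++ v) :=
  wid u ⊗ f ⊗ wid v.

Lemma lay_wrap x y (f : whom x y) ex ey : f = wcast ex ey (lay [::] f [::]).
Proof.
apply: heq_eq; apply: heq_sym; apply: heq_trans (heq_wcast _ _ _) _.
by rewrite /lay wten1l; apply: heq_wten1r.
Qed.

Lemma lay_id u w v : lay u (wid w) v = wid (u ++ w ++ v).
Proof. by rewrite /lay !wten1. Qed.

Lemma lay_comp u x y z (g : whom y z) (f : whom x y) v :
  lay u (g ∘ f) v = lay u g v ∘ lay u f v.
Proof. by rewrite /lay -wtenM -wtenM !wcomp1. Qed.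

Lemma heq_lay u x y (f : whom x y) u' v' v :
  heq (lay (u ++ u') f (v' ++ v)) (lay u (lay u' f v') v).
Proof.
rewrite /lay -!wten1; apply: heq_trans (heq_wtenA _ _ _) _.
apply: heq_wten2; first exact: heq_refl.
apply: heq_sym; apply: heq_trans (heq_wtenA _ _ _) _.
apply: heq_wten2; first exact: heq_refl.
exact: heq_wtenA.
Qed.

Lemma lay_lay u x y (f : whom x y) u' v' v ex ey :
  wcast ex ey (lay u (lay u' f v') v) = lay (u ++ u') f (v' ++ v).
Proof.
apply: heq_eq; apply: heq_trans (heq_wcast _ _ _) _; exact/heq_sym/heq_lay.
Qed.

Lemma lay_ten u x y x' y' (f : whom x y) (g : whom x' y') v
    (e1 : _ = u ++ (x ++ y') ++ v) e2 e3 e4 :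
  lay u (f ⊗ g) v
  = wcast e1 e2 (lay u f (y' ++ v)) ∘ wcast e3 e4 (lay (u ++ x) g v).
Proof.
rewrite wten_lr lay_comp; congr wcomp; apply: heq_eq; apply: heq_sym.
- apply: heq_trans (heq_wcast _ _ _) _; rewrite /lay -wten1.
  apply: heq_wten2; first exact: heq_refl.
  exact/heq_sym/heq_wtenA.
- apply: heq_trans (heq_wcast _ _ _) _; rewrite /lay -wten1.
  apply: heq_trans (heq_wtenA _ _ _) _.
  apply: heq_wten2; first exact: heq_refl.
  exact/heq_sym/heq_wtenA.
Qed.

(** Two boxes without a common string may be applied in either order; w is the
  word of strings between them. *)
Lemma lay_exchange u x y w x' y' v (f : whom x y) (g : whom x' y') e1 e2 e3 e4 :
  wcast e1 e2 (lay (u ++ y ++ w) g v) ∘ lay u f (w ++ x' ++ v)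
  = lay u f (w ++ y' ++ v) ∘ wcast e3 e4 (lay (u ++ x ++ w) g v).
Proof.
have E z e e' : wcast e e' (lay (u ++ z ++ w) g v) = wid u ⊗ wid z ⊗ lay w g v.
  apply: heq_eq; apply: heq_trans (heq_wcast _ _ _) _.
  rewrite /lay -!wten1; apply: heq_trans (heq_wtenA _ _ _) _.
  apply: heq_wten2; [exact: heq_refl | exact: heq_wtenA].
by rewrite !E {1 3}/lay -!wtenM !wcomp1 !wcomp1l.
Qed.
End Layers.

(* In the tactics below all words are explicit, so that the casts of the lemmas
   above are taken along [erefl] and compute away. *)
Ltac drop_word l U :=
  lazymatch l with
  | nil => U
  | cons _ ?l' => lazymatch U with cons _ ?U' => drop_word l' U' end
  end.

Ltac clean E := cbn [wcast cat] in E.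

Ltac layer_step :=
  match goal with
  | |- context [ @lay _ ?u _ _ (wcomp ?g ?f) ?v ] => rewrite (lay_comp u g f v)
  | |- context [ @lay _ ?u _ _ (wid ?w) ?v ] => rewrite (lay_id u w v) ?wcomp1 ?wcomp1l
  | |- context [ @lay _ ?u _ _ (wten ?f ?g) ?v ] =>
      let E := fresh in
      pose proof (@lay_ten _ u _ _ _ _ f g v erefl erefl erefl erefl) as E;
      clean E; rewrite E; clear E
  | |- context [ @lay _ ?u _ _ (@lay _ ?u' _ _ ?f ?v') ?v ] =>
      let E := fresh in
      pose proof (@lay_lay _ u _ _ f u' v' v erefl erefl) as E;
      clean E; rewrite E; clear E
  end.

(* Turns both sides of an equation into right-bracketed composites of layers. *)
Ltac layers :=
  match goal with
  | |- ?s = ?t =>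
      let E := fresh in let E' := fresh in
      pose proof (@lay_wrap _ _ _ s erefl erefl) as E;
      pose proof (@lay_wrap _ _ _ t erefl erefl) as E';
      clean E; clean E'; rewrite [LHS]E [RHS]E'; clear E E'
  end; repeat layer_step; rewrite ?wcomp1 ?wcomp1l -?wcompA; cbn [cat].

Ltac exchange_at U g V' u y f v :=
  let U' := eval cbn [cat] in U in
  let l := eval cbn [cat] in (u ++ y) in
  let w := drop_word l U' in
  let E := fresh in
  pose proof (@lay_exchange _ u _ _ w _ _ V' f g erefl erefl erefl erefl) as E;
  clean E;
  first [ rewrite E | rewrite (wcompA (lay U g V') (lay u f v)) E -?wcompA ];
  clear E.

(* One step towards the normal form in which, of two consecutive independent boxes,
   the left one is applied last. *)
Ltac exchange :=
  match goal with
  | |- context [ wcomp (@lay _ ?U _ _ ?g ?V') (@lay _ ?u _ ?y ?f ?v) ] =>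
      exchange_at U g V' u y f v
  | |- context [ wcomp (@lay _ ?U _ _ ?g ?V') (wcomp (@lay _ ?u _ ?y ?f ?v) _) ] =>
      exchange_at U g V' u y f v
  end.

Ltac exchangeV_at u f v U x g V' :=
  let U' := eval cbn [cat] in U in
  let l := eval cbn [cat] in (u ++ x) in
  let w := drop_word l U' in
  let E := fresh in
  pose proof (@lay_exchange _ u _ _ w _ _ V' f g erefl erefl erefl erefl) as E;
  clean E;
  first [ rewrite -E | rewrite (wcompA (lay u f v) (lay U g V')) -E -?wcompA ];
  clear E.

(* The opposite step, for the boxes f and g: it is needed when a rule applies to g
   and the box before f. *)
Ltac exchangeV f g :=
  match goal with
  | |- context [ wcomp (@lay _ ?u ?x _ f ?v) (@lay _ ?U _ _ g ?V') ] =>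
      exchangeV_at u f v U x g V'
  | |- context [ wcomp (@lay _ ?u ?x _ f ?v) (wcomp (@lay _ ?U _ _ g ?V') _) ] =>
      exchangeV_at u f v U x g V'
  end.

(* E is first brought to layered form in the context of the words u and v, so that
   its left-hand side occurs literally in a layered goal. *)
Ltac layer_rewrite E u v :=
  let H := fresh in
  pose proof (congr1 (fun t => lay u t v) E) as H; cbv beta in H;
  move: H; repeat layer_step; rewrite ?wcomp1 ?wcomp1l -?wcompA; cbn [cat]; move=> H;
  lazymatch type of H with
  | wcomp ?f (wcomp ?g ?k) = _ =>
      first [rewrite H | rewrite (wcompA g k) (wcompA f (wcomp g k)) H]
  | wcomp ?f ?g = _ => first [rewrite H | rewrite (wcompA f g) H]
  | _ => rewrite H
  end; clear H; rewrite ?wcomp1 ?wcomp1l -?wcompA; cbn [cat].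

(** * Braidings *)

Section Braiding.
Variable V : strict_braided.

Lemma heq_braid_tenr (X Y Z : V) : heq (braid X (tenO Y Z))
  ((id1 Y ⊗ braid X Z) ∘ (braid X Y ⊗ id1 Z)).
Proof. by rewrite -braid_hexl; apply/heq_sym/heq_eqhoml. Qed.

Lemma heq_braid_tenl (X Y Z : V) : heq (braid (tenO X Y) Z)
  ((braid X Z ⊗ id1 Y) ∘ (id1 X ⊗ braid Y Z)).
Proof. by rewrite -braid_hexr; apply/heq_sym/heq_eqhomr. Qed.

(** The next four lemmas slide a box with two strings on one side past a single
  string: naturality turns the box into a braiding with the product of the two
  strings, and a hexagon axiom splits that braiding. *)
Lemma braid_mulr (X Y Z W : V) (f : whom [:: Y; Z] [:: W]) :
  braid X W ∘ (id1 X ⊗ f) = (f ⊗ id1 X) ∘ (id1 Y ⊗ braid X Z) ∘ (braid X Y ⊗ id1 Z).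
Proof.
apply: heq_eq; apply: heq_trans (heq_comp (heq_refl (braid X W)) (heq_wten (id1 X) f)) _.
apply: heq_trans (eq_heq (@braid_nat V X X (tenO Y Z) W (id1 X) f)) _.
apply: heq_comp; [exact: heq_sym (heq_wten f (id1 X)) | exact: heq_braid_tenr].
Qed.

Lemma braid_mull (X Y Z W : V) (f : whom [:: X; Y] [:: W]) :
  braid W Z ∘ (f ⊗ id1 Z) = (id1 Z ⊗ f) ∘ (braid X Z ⊗ id1 Y) ∘ (id1 X ⊗ braid Y Z).
Proof.
apply: heq_eq; apply: heq_trans (heq_comp (heq_refl (braid W Z)) (heq_wten f (id1 Z))) _.
apply: heq_trans (eq_heq (@braid_nat V (tenO X Y) W Z Z f (id1 Z))) _.
apply: heq_comp; [exact: heq_sym (heq_wten (id1 Z) f) | exact: heq_braid_tenl].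
Qed.

Lemma braid_comulr (X Y Z W : V) (f : whom [:: W] [:: Y; Z]) :
  (f ⊗ id1 X) ∘ braid X W = (id1 Y ⊗ braid X Z) ∘ (braid X Y ⊗ id1 Z) ∘ (id1 X ⊗ f).
Proof.
apply: heq_eq; apply: heq_trans (heq_comp (heq_wten f (id1 X)) (heq_refl (braid X W))) _.
apply: heq_trans (eq_heq (esym (@braid_nat V X X W (tenO Y Z) (id1 X) f))) _.
rewrite wcompA; apply: heq_comp; [exact: heq_braid_tenr | exact: heq_sym (heq_wten (id1 X) f)].
Qed.

Lemma braid_comull (X Y Z W : V) (f : whom [:: W] [:: X; Y]) :
  (id1 Z ⊗ f) ∘ braid W Z = (braid X Z ⊗ id1 Y) ∘ (id1 X ⊗ braid Y Z) ∘ (f ⊗ id1 Z).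
Proof.
apply: heq_eq; apply: heq_trans (heq_comp (heq_wten (id1 Z) f) (heq_refl (braid W Z))) _.
apply: heq_trans (eq_heq (esym (@braid_nat V W (tenO X Y) Z Z f (id1 Z)))) _.
rewrite wcompA; apply: heq_comp; [exact: heq_braid_tenl | exact: heq_sym (heq_wten f (id1 Z))].
Qed.

(** By the hexagon axiom at I ⊗ I = I the braiding with I is idempotent; being
  invertible, it is the identity. *)
Lemma heq_braid1r (X : V) : heq (braid X unitO) (id1 X).
Proof.
have hI (Y Y' : V) : Y = Y' -> heq (braid X Y) (braid X Y').
  by move=> e; destruct e; apply: heq_refl.
pose b : Hom X X := hcast (tenO1 X) (ten1O X) (braid X unitO).
have hb : heq (braid X unitO) b by exists (tenO1 X), (ten1O X).
have bb : compm b b = b.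
  have h1 : heq (id1 unitO ⊗ braid X unitO) b.
    exact: (heq_trans (heq_wten (id1 unitO) _) (heq_trans (heq_ten1M (braid X unitO)) hb)).
  have h2 : heq (braid X unitO ⊗ id1 unitO) b.
    exact: (heq_trans (heq_wten _ (id1 unitO)) (heq_trans (heq_tenM1 (braid X unitO)) hb)).
  apply: heq_eq; apply: (heq_trans (heq_sym (heq_comp h1 h2))).
  apply: heq_trans (heq_sym (heq_braid_tenr X unitO unitO)) _.
  exact: (heq_trans (hI _ _ (ten1O unitO)) hb).
have [c [cb _]] : is_iso b.
  rewrite /b; move: (tenO1 X) (ten1O X) (braid_iso X unitO).
  move: (braid X unitO); rewrite /whom /=; generalize (tenO X unitO) (tenO unitO X).
  by move=> Y Z f eY eZ; destruct eY, eZ.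
apply: heq_trans hb _; apply: eq_heq.
by rewrite -[b]comp1m -cb -compmA bb.
Qed.

Lemma braid_unitr (X Y : V) (e : whom [::] [:: Y]) :
  braid X Y ∘ (id1 X ⊗ e) = e ⊗ id1 X.
Proof.
pose e' : whom [:: unitO] [:: Y] := e.
apply: heq_eq; apply: (heq_trans (g := braid X Y ∘ (id1 X ⊗ e'))).
  exact: (heq_comp (heq_refl _) (heq_wten2 (f := id1 X) (g := id1 X) (heq_refl _)
    (f' := e) (g' := e') (heq_refl e))).
rewrite wbraid_nat -(wcomp1 (e ⊗ id1 X)).
exact: (heq_comp (heq_wten2 (f := e') (g := e) (f' := id1 X) (g' := id1 X)
  (heq_refl e) (heq_refl _)) (heq_braid1r X)).
Qed.

Lemma braid_counitl (X Y : V) (e : whom [:: X] [::]) :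
  (id1 Y ⊗ e) ∘ braid X Y = e ⊗ id1 Y.
Proof.
pose e' : whom [:: X] [:: unitO] := e.
apply: heq_eq; apply: (heq_trans (g := (id1 Y ⊗ e') ∘ braid X Y)).
  exact: (heq_comp (heq_wten2 (f := id1 Y) (g := id1 Y) (heq_refl _)
    (f' := e) (g' := e') (heq_refl e)) (heq_refl _)).
rewrite -wbraid_nat -(wcomp1l (e ⊗ id1 Y)).
exact: (heq_comp (heq_braid1l Y) (heq_wten2 (f := e') (g := e) (f' := id1 Y) (g' := id1 Y)
  (heq_refl e) (heq_refl _))).
Qed.
End Braiding.

(** * The entwining structure of a comodule algebra *)

Section Entwining.
Variables (V : strict_braided) (H : bialgebra V) (A : comodule_algebra H).
Let h : V := bi_ob H.
Let a : V := ca_ob A.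
Let m : whom [:: a; a] [:: a] := mul (ca_alg A).
Let e : whom [::] [:: a] := one (ca_alg A).
Let al : whom [:: a] [:: a; h] := ca_coact A.
Let mH : whom [:: h; h] [:: h] := mul (bi_alg H).
Let eH : whom [::] [:: h] := one (bi_alg H).
Let eps : whom [:: h] [::] := counit (bi_coalg H).
Let del : whom [:: h] [:: h; h] := comult (bi_coalg H).
Let lamE : entwining A = (id1 a ⊗ mH) ∘ (braid h a ⊗ id1 h) ∘ (id1 h ⊗ al)
  := entwiningE A.

(** The four lemmas of this section are the axioms of an entwining structure, for
  the morphism h ⊗ b |-> b_0 ⊗ h b_1. Each axiom comes from the corresponding
  compatibility of the coaction of A or of the bialgebra H. *)
Lemma entwining_unit :
  entwining A ∘ (id1 (bi_ob H) ⊗ one (ca_alg A)) = one (ca_alg A) ⊗ id1 (bi_ob H).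
Proof.
have alE : al ∘ e = (e ⊗ eH) := (ca_coact_alg A).2.
rewrite lamE -/e -/h; layers.
layer_rewrite alE [:: h] (@nil V).
layer_rewrite (braid_unitr h e) (@nil V) [:: h].
exchangeV e eH.
by layer_rewrite (mul_oner (bi_alg H)) [:: a] (@nil V).
Qed.

Lemma entwining_counit :
  (id1 (ca_ob A) ⊗ counit (bi_coalg H)) ∘ entwining A = counit (bi_coalg H) ⊗ id1 (ca_ob A).
Proof.
have epsE : eps ∘ mH = wid [::] ∘ (eps ⊗ eps) := (bi_counitP H).1.
have alE : (id1 a ⊗ eps) ∘ al = id1 a := (ca_coactP A).2.
rewrite lamE -/a -/h -/eps; layers.
layer_rewrite epsE [:: a] (@nil V).
exchange.
layer_rewrite alE [:: h] (@nil V).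
by layer_rewrite (braid_counitl a eps) (@nil V) (@nil V).
Qed.

(** Both sides are h ⊗ b ⊗ c |-> b_0 c_0 ⊗ h b_1 c_1: the coaction is multiplicative
  and the multiplication of H is associative. *)
Lemma entwining_mul :
  entwining A ∘ (id1 (bi_ob H) ⊗ mul (ca_alg A))
  = (mul (ca_alg A) ⊗ id1 (bi_ob H)) ∘ (id1 (ca_ob A) ⊗ entwining A)
      ∘ (entwining A ⊗ id1 (ca_ob A)).
Proof.
have alM : al ∘ m = ((m ⊗ mH) ∘ (id1 a ⊗ braid h a ⊗ id1 h)) ∘ (al ⊗ al)
  := (ca_coact_alg A).1.
rewrite lamE -/m -/a -/h; layers.
layer_rewrite alM [:: h] (@nil V).
layer_rewrite (braid_mulr h m) (@nil V) [:: h].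
do !exchange.
layer_rewrite (braid_mull a mH) [:: a] [:: h].
do 2!exchangeV (braid h a) mH.
layer_rewrite (mul_assoc (bi_alg H)) [:: a; a] (@nil V).
by do !exchange.
Qed.

(** Both sides are h ⊗ b |-> b_0 ⊗ h_1 b_1 ⊗ h_2 b_2: the comultiplication of H is
  multiplicative and the coaction is coassociative. *)
Lemma entwining_comult :
  (id1 (ca_ob A) ⊗ comult (bi_coalg H)) ∘ entwining A
  = (entwining A ⊗ id1 (bi_ob H)) ∘ (id1 (bi_ob H) ⊗ entwining A)
      ∘ (comult (bi_coalg H) ⊗ id1 (ca_ob A)).
Proof.
have delE : del ∘ mH = ((mH ⊗ mH) ∘ (id1 h ⊗ braid h h ⊗ id1 h)) ∘ (del ⊗ del)
  := (bi_comultP H).1.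
rewrite lamE -/a -/h -/del; layers.
layer_rewrite delE [:: a] (@nil V).
do !exchange.
layer_rewrite (braid_comull a del) (@nil V) [:: h; h].
layer_rewrite (esym (ca_coactP A).1) [:: h] (@nil V).
exchangeV al mH.
layer_rewrite (braid_comulr h al) [:: h] [:: h].
by do !exchange.
Qed.
End Entwining.

(** * Cofree entwined modules *)

Section Cofree.
Variables (V : strict_braided) (H : bialgebra V) (A : comodule_algebra H).
Let h : V := bi_ob H.
Let a : V := ca_ob A.
Let m : whom [:: a; a] [:: a] := mul (ca_alg A).
Let e : whom [::] [:: a] := one (ca_alg A).
Let eps : whom [:: h] [::] := counit (bi_coalg H).
Let del : whom [:: h] [:: h; h] := comult (bi_coalg H).
Let lam : whom [:: h; a] [:: a; h] := entwining A.

Section OnModule.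
Variable M : rmodule (ca_alg A).
Let x := rm_ob M.
Let xi : whom [:: x; a] [:: x] := rm_act M.

Definition cofree_ob : V := tenO (rm_ob M) (bi_ob H).

(** The carrier of the cofree entwined module has to be one letter, whereas its
  structure is naturally given on the word [x; H]. The identity morphism of x ⊗ H
  is treated as a pair of mutually inverse boxes between the two words, so that
  diagrams need no cast. *)
Definition cofree_fold : whom [:: rm_ob M; bi_ob H] [:: cofree_ob] :=
  idm (tenO (rm_ob M) (bi_ob H)).
Definition cofree_unfold : whom [:: cofree_ob] [:: rm_ob M; bi_ob H] :=
  idm (tenO (rm_ob M) (bi_ob H)).

Let q := cofree_fold.
Let q' := cofree_unfold.

Lemma cofree_foldK : cofree_unfold ∘ cofree_fold = wid [:: rm_ob M; bi_ob H].
Proof. exact: comp1m. Qed.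

Lemma cofree_unfoldK : cofree_fold ∘ cofree_unfold = id1 cofree_ob.
Proof. exact: comp1m. Qed.

Definition cofree_act : whom [:: cofree_ob; ca_ob A] [:: cofree_ob] :=
  cofree_fold ∘ (rm_act M ⊗ id1 (bi_ob H)) ∘ (id1 (rm_ob M) ⊗ entwining A)
    ∘ (cofree_unfold ⊗ id1 (ca_ob A)).

Definition cofree_coact : whom [:: cofree_ob] [:: cofree_ob; bi_ob H] :=
  (cofree_fold ⊗ id1 (bi_ob H)) ∘ (id1 (rm_ob M) ⊗ comult (bi_coalg H)) ∘ cofree_unfold.

Lemma cofree_actP : is_rmodule (ca_alg A) cofree_act.
Proof.
have [xiA xi1] := rm_actP M; split.
- rewrite /cofree_act -/q -/q' -/x -/xi -/h -/a -/m -/lam; layers.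
  layer_rewrite cofree_foldK (@nil V) [:: a].
  exchangeV q' m.
  layer_rewrite (entwining_mul A) [:: x] (@nil V).
  layer_rewrite (esym xiA) (@nil V) [:: h].
  by do !exchange.
- rewrite /cofree_act -/q -/q' -/x -/xi -/h -/a -/e -/lam; layers.
  exchangeV q' e.
  layer_rewrite (entwining_unit A) [:: x] (@nil V).
  layer_rewrite xi1 (@nil V) [:: h].
  by layer_rewrite cofree_unfoldK (@nil V) (@nil V).
Qed.

Lemma cofree_coactP : is_rcomodule (bi_coalg H) cofree_coact.
Proof.
split.
- rewrite /cofree_coact -/q -/q' -/x -/h -/del; layers.
  layer_rewrite cofree_foldK (@nil V) [:: h].
  do !exchange.
  by layer_rewrite (comult_coassoc (bi_coalg H)) [:: x] (@nil V).
- rewrite /cofree_coact -/q -/q' -/x -/h -/eps; layers.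
  exchange.
  layer_rewrite (comult_counitr (bi_coalg H)) [:: x] (@nil V).
  by layer_rewrite cofree_unfoldK (@nil V) (@nil V).
Qed.

Lemma cofree_compat : cofree_coact ∘ cofree_act
  = (cofree_act ⊗ id1 (bi_ob H)) ∘ (id1 cofree_ob ⊗ entwining A)
      ∘ (cofree_coact ⊗ id1 (ca_ob A)).
Proof.
rewrite /cofree_act /cofree_coact -/q -/q' -/x -/xi -/h -/a -/del -/lam; layers.
layer_rewrite cofree_foldK (@nil V) (@nil V).
exchange.
layer_rewrite (entwining_comult A) [:: x] (@nil V).
do !exchange.
by layer_rewrite cofree_foldK (@nil V) [:: a; h].
Qed.

Definition cofree : emodule (ca_alg A) (bi_coalg H) (entwining A) :=
  @EModule _ _ _ _ _ _ (RModule cofree_actP) cofree_coact cofree_coactP cofree_compat.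
End OnModule.
End Cofree.

(** * The canonical morphism of an arbitrary module *)

Lemma coeq_wtenl (V : base_category) (u v w : seq V) (Q : V) (f g : whom u v) (q : whom v [:: Q]) :
  is_coequalizer f g q -> is_coequalizer (wid w ⊗ f) (wid w ⊗ g) (wid w ⊗ q).
Proof.
by move=> /(tenM_coeql (prodw w)); apply: is_coequalizer_heq; apply: heq_sym; exact: heq_wten.
Qed.

Section CanonicalMap.
Variables (V : base_category) (H : bialgebra V) (A : comodule_algebra H).
Let h : V := bi_ob H.
Let a : V := ca_ob A.
Let i : whom [:: coinv A] [:: a] := coinv_in A.
Let m : whom [:: a; a] [:: a] := mul (ca_alg A).
Let e : whom [::] [:: a] := one (ca_alg A).
Let al : whom [:: a] [:: a; h] := ca_coact A.
Let eps : whom [:: h] [::] := counit (bi_coalg H).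
Let del : whom [:: h] [:: h; h] := comult (bi_coalg H).
Let iP := coinv_algP A.
Let L := coinv_l A.

Section OneModule.
Variable M : rmodule (ca_alg A).
Let x := rm_ob M.
Let xi : whom [:: x; a] [:: x] := rm_act M.

(** The morphism x ⊗ b |-> x b_0 ⊗ b_1; it descends to M ⊗_B A because the coaction
  of A is left linear over the coinvariants. *)
Definition free_map : whom [:: rm_ob M; ca_ob A] [:: rm_ob M; bi_ob H] :=
  (rm_act M ⊗ id1 (bi_ob H)) ∘ (id1 (rm_ob M) ⊗ ca_coact A).

Lemma free_map_balanced :
  free_map ∘ (rm_act (restr_r (coinv_algP A) M) ⊗ id1 (lm_ob (coinv_l A)))
  = free_map ∘ (id1 (rm_ob (restr_r (coinv_algP A) M)) ⊗ lm_act (coinv_l A)).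
Proof.
rewrite /free_map /= -/m -/i -/a -/h -/al -/x -/xi -!wcompA.
wmerge; wmerge; rewrite coact_coinvl -/m -/i -/a -/h -/al !wcomp1 !wcomp1l.
have -> : (xi ∘ (id1 x ⊗ i)) ⊗ al = (xi ⊗ id1 a ⊗ id1 h) ∘ ((id1 x ⊗ i) ⊗ al).
  by wmerge; rewrite wten1 wcomp1l.
have -> : id1 x ⊗ ((m ⊗ id1 h) ∘ (i ⊗ al)) = (id1 x ⊗ m ⊗ id1 h) ∘ (id1 x ⊗ i ⊗ al).
  by wmerge; rewrite wcomp1.
wassoc (id1 x) i al; rewrite !wcompA; congr wcomp.
wassocV xi (id1 a) (id1 h); wassocV (id1 x) m (id1 h); wmerge; wmerge.
by rewrite (rm_actP M).1.
Qed.

Definition can_at : whom [:: ten_over (restr_r (coinv_algP A) M) (coinv_l A)]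
    [:: rm_ob M; bi_ob H] :=
  coeq_desc (ten_piP (restr_r (coinv_algP A) M) (coinv_l A)) free_map_balanced.

Lemma can_atE : can_at ∘ ten_pi (restr_r (coinv_algP A) M) (coinv_l A) = free_map.
Proof. exact: coeq_descE. Qed.

(** Both sides are x ⊗ b ⊗ c |-> x b c_0 ⊗ c_1. *)
Lemma free_map_act : free_map ∘ (rm_act M ⊗ id1 (ca_ob A))
  = (rm_act M ⊗ id1 (bi_ob H)) ∘ (id1 (rm_ob M) ⊗ (mul (ca_alg A) ⊗ id1 (bi_ob H)))
    ∘ (id1 (rm_ob M) ⊗ id1 (ca_ob A) ⊗ ca_coact A).
Proof.
rewrite /free_map -/x -/xi -/a -/h -/m -/al -wcompA; wmerge; rewrite wcomp1 wcomp1l.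
have -> : xi ⊗ al = (xi ⊗ id1 a ⊗ id1 h) ∘ (id1 x ⊗ id1 a ⊗ al).
  wassocV (id1 x) (id1 a) al; wmerge.
  by rewrite !wten1 wcomp1 wcomp1l.
rewrite !wcompA; congr wcomp.
wassocV xi (id1 a) (id1 h); wassocV (id1 x) m (id1 h); wmerge; wmerge.
by rewrite (rm_actP M).1.
Qed.

(** The right-hand side uses the action of A on M ⊗ H through the entwining, so this
  is the A-linearity of [can_at M]; it reduces to the multiplicativity of the
  coaction in the form [coact_mul_entwining]. *)
Lemma can_at_linear : can_at ∘ ext_act (coinv_algP A) (restr_r (coinv_algP A) M)
  = (rm_act M ⊗ id1 (bi_ob H)) ∘ (id1 (rm_ob M) ⊗ entwining A)
    ∘ (can_at ⊗ id1 (ca_ob A)).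
Proof.
apply: (@ten_pi_epi _ _ _ (restr_r iP M) L [:: a]).
rewrite -!wcompA (ext_actE iP (restr_r iP M)) (wcompA can_at) can_atE.
wmerge; rewrite can_atE wcomp1 /free_map -/x -/xi -/a -/h -/m -/al /=.
have -> : ((xi ⊗ id1 h) ∘ (id1 x ⊗ al)) ⊗ id1 a
   = (xi ⊗ id1 h ⊗ id1 a) ∘ (id1 x ⊗ al ⊗ id1 a).
  wassocV xi (id1 h) (id1 a); wassocV (id1 x) al (id1 a); by wmerge; rewrite wcomp1.
rewrite (wcompA (id1 x ⊗ entwining A)); wmerge; rewrite wten1 wcomp1l wcomp1.
have -> : xi ⊗ entwining A = (xi ⊗ id1 a ⊗ id1 h) ∘ ((id1 x ⊗ id1 a) ⊗ entwining A).
  by wmerge; rewrite !wten1 wcomp1 wcomp1l.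
wassoc (id1 x) (id1 a) (entwining A).
rewrite -wcompA.
have -> : (id1 x ⊗ al) ∘ (id1 x ⊗ m) = id1 x ⊗ (al ∘ m) by wmerge; rewrite wcomp1.
rewrite [al ∘ m]coact_mul_entwining -/m -/a -/h -/al.
rewrite -!wcompA (wcompA (xi ⊗ id1 h) (xi ⊗ _)); wassocV xi (id1 a) (id1 h).
wmerge; rewrite (rm_actP M).1 -/xi -/m wcomp1 wtenMl -!wcompA; congr wcomp.
wassoc (id1 x) m (id1 h).
by do 2!wmerge; rewrite !wcomp1.
Qed.

(** This is the compatibility of [can_at] with the counits of the two comonads. *)
Lemma can_at_counit : (id1 (rm_ob M) ⊗ counit (bi_coalg H)) ∘ can_at
  = scal_counit (coinv_algP A) M.
Proof.
apply: ten_pi_epi1; rewrite (scal_counitE iP M) -wcompA can_atE /free_map.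
rewrite -/x -/xi -/a -/h -/al -/eps wcompA; wmerge; rewrite wcomp1l wcomp1.
have E : xi ⊗ eps = xi ∘ (id1 x ⊗ id1 a ⊗ eps).
  have E1 : xi ⊗ wid [::] = xi by exact: (wten1r xi erefl erefl).
  by wassocV (id1 x) (id1 a) eps; rewrite -{2}E1; wmerge; rewrite wten1 wcomp1 wcomp1l.
rewrite E -wcompA; wmerge.
by rewrite (ca_coactP A).2 wcomp1 wten1 wcomp1.
Qed.

(** This is the compatibility of [can_at] with the comultiplications of the two
  comonads, by [fbar_coact_can_at]; it reduces to the coassociativity of the
  coaction of A. *)
Lemma can_at_colinear : (id1 (rm_ob M) ⊗ comult (bi_coalg H)) ∘ can_at
  = (can_at ⊗ id1 (bi_ob H)) ∘ fbar_coact (restr_r (coinv_algP A) M).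
Proof.
apply: ten_pi_epi1; rewrite -!wcompA can_atE fbar_coactE.
wmerge; rewrite can_atE /free_map -/x -/xi -/a -/h -/al -/del wcomp1.
rewrite wcompA; wmerge; rewrite wcomp1l wcomp1.
have -> : xi ⊗ del = (xi ⊗ id1 h ⊗ id1 h) ∘ (id1 x ⊗ id1 a ⊗ del).
  by wassocV (id1 x) (id1 a) del; wmerge; rewrite !wten1 wcomp1 wcomp1l.
rewrite -wcompA; wmerge; rewrite -[(id1 a ⊗ del) ∘ al](ca_coactP A).1 -/al -/h wcomp1.
rewrite wtenMl; wassoc xi (id1 h) (id1 h); wassoc (id1 x) al (id1 h).
rewrite -!wcompA; congr wcomp; wmerge; by rewrite wcomp1.
Qed.
End OneModule.

Lemma can_at_natural (M N : rmodule (ca_alg A)) (f : whom [:: rm_ob M] [:: rm_ob N])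
    (fP : is_rlinear f) :
  can_at N ∘ ten_mapl (coinv_l A) (restr_linear (coinv_algP A) fP)
  = (f ⊗ id1 (bi_ob H)) ∘ can_at M.
Proof.
apply: (@ten_pi_epi1 _ _ _ (restr_r iP M)).
rewrite -!wcompA ten_maplE /= (wcompA (can_at N)) !can_atE /free_map -/a -/h -/al.
rewrite -wcompA; wmerge; rewrite !wcomp1l wcomp1 (wcompA (f ⊗ id1 h)); wmerge.
rewrite wcomp1l fP -/a.
have -> : (rm_act N ∘ (f ⊗ id1 a)) ⊗ id1 h = (rm_act N ⊗ id1 h) ∘ (f ⊗ id1 a ⊗ id1 h).
  by wassocV f (id1 a) (id1 h); wmerge; rewrite wcomp1.
rewrite -wcompA; wmerge; by rewrite wten1 wcomp1 wcomp1l.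
Qed.

(** The coaction on X ⊗_B A is the image under [can_at] of the coalgebra structure
  that the comparison functor puts on X ⊗_B A. *)
Lemma fbar_coact_can_at (X : rmodule (coinv_alg A)) :
  can_at (ext_ob (coinv_algP A) X)
    ∘ ten_mapl (coinv_l A) (scal_unit_linear (coinv_algP A) X)
  = fbar_coact X.
Proof.
apply: ten_pi_epi1; rewrite -wcompA ten_maplE /= fbar_coactE.
rewrite (wcompA (can_at (ext_ob iP X))) (can_atE (ext_ob iP X)).
rewrite /free_map /= -/a -/h -/al /scal_unit -/e -wcompA; wmerge; rewrite wcomp1l wcomp1.
set x := rm_ob X; set p := ten_pi X _.
have -> : (p ∘ (id1 x ⊗ e)) ⊗ al = (p ⊗ id1 a ⊗ id1 h) ∘ (id1 x ⊗ e ⊗ al).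
  by wassocV (id1 x) e al; wmerge; rewrite wten1 wcomp1l.
have E := ext_actE iP X; rewrite -/m -/a -/x -/p in E.
wassocV p (id1 a) (id1 h); rewrite wcompA; wmerge; rewrite E wcomp1 wtenMl -wcompA.
congr wcomp; wassoc (id1 x) m (id1 h); wmerge.
have -> : e ⊗ al = (e ⊗ id1 a ⊗ id1 h) ∘ al.
  by rewrite -{2}[al]wten1l; wmerge; rewrite wten1 wcomp1 wcomp1l.
wassocV e (id1 a) (id1 h); rewrite wcompA; wmerge.
by rewrite [m ∘ _](mul_onel (ca_alg A)) !wcomp1 wten1 wcomp1l.
Qed.
End CanonicalMap.

(** * Invertibility of the canonical morphisms in the Galois case *)

Section GaloisInverse.
Variables (V : base_category) (H : bialgebra V) (A : comodule_algebra H).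
Let h : V := bi_ob H.
Let a : V := ca_ob A.
Let i : whom [:: coinv A] [:: a] := coinv_in A.
Let m : whom [:: a; a] [:: a] := mul (ca_alg A).
Let e : whom [::] [:: a] := one (ca_alg A).
Let al : whom [:: a] [:: a; h] := ca_coact A.
Let iP := coinv_algP A.
Let L := coinv_l A.

Definition reg_r : rmodule (ca_alg A) := RModule (reg_rP A).

Let TA : V := ten_over (coinv_r A) L.
Let pA : whom [:: a; a] [:: TA] := ten_pi (coinv_r A) L.

Lemma can_at_reg : can_at reg_r = can A.
Proof.
apply: (@ten_pi_epi1 _ _ _ (coinv_r A)).
by rewrite (can_atE reg_r) [RHS](coeq_descE (ten_piP (coinv_r A) L) (canP A)).
Qed.

Section Action.
Variable M : rmodule (ca_alg A).
Let x := rm_ob M.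
Let xi : whom [:: x; a] [:: x] := rm_act M.
Let T : V := ten_over (restr_r iP M) L.
Let p : whom [:: x; a] [:: T] := ten_pi (restr_r iP M) L.

(** Both sides are x ⊗ b ⊗ c ⊗ d |-> x b c ⊗ d, for c in B. *)
Lemma balanced_act_subproof :
  (ten_pi (restr_r (coinv_algP A) M) (coinv_l A) ∘ (rm_act M ⊗ id1 (ca_ob A)))
    ∘ (id1 (rm_ob M) ⊗ (rm_act (coinv_r A) ⊗ id1 (lm_ob (coinv_l A))))
  = (ten_pi (restr_r (coinv_algP A) M) (coinv_l A) ∘ (rm_act M ⊗ id1 (ca_ob A)))
    ∘ (id1 (rm_ob M) ⊗ (id1 (rm_ob (coinv_r A)) ⊗ lm_act (coinv_l A))).
Proof.
rewrite /= -/m -/i -/a -/x -/xi -/p -!wcompA.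
have E := ten_piE (restr_r iP M) L; rewrite /= -/x -/a -/i -/m -/xi -/p in E.
have -> : (xi ⊗ id1 a) ∘ (id1 x ⊗ id1 a ⊗ (m ∘ i ⊗ id1 a))
   = (id1 x ⊗ (m ∘ i ⊗ id1 a)) ∘ (xi ⊗ id1 (coinv A) ⊗ id1 a).
  wassocV (id1 x) (id1 a) (m ∘ i ⊗ id1 a).
  by do 2!wmerge; rewrite !wten1 !wcomp1 !wcomp1l.
rewrite [RHS]wcompA -E -[RHS]wcompA; congr wcomp.
wassocV (id1 x) (m ∘ id1 a ⊗ i) (id1 a); wassocV xi (id1 (coinv A)) (id1 a).
wmerge; wmerge; rewrite !wcomp1.
suff -> : xi ∘ id1 x ⊗ (m ∘ id1 a ⊗ i) = (xi ∘ id1 x ⊗ i) ∘ xi ⊗ id1 (coinv A) by [].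
rewrite wtenMr [LHS]wcompA -[xi ∘ _](rm_actP M).1 -/xi -/a -!wcompA; congr wcomp.
wassocV (id1 x) (id1 a) i.
by do 2!wmerge; rewrite wten1 !wcomp1 !wcomp1l.
Qed.

(** The action of M on the first factor; it exists because M ⊗ - preserves the
  coequalizer A ⊗_B A. *)
Definition balanced_act : whom [:: rm_ob M; ten_over (coinv_r A) (coinv_l A)]
    [:: ten_over (restr_r (coinv_algP A) M) (coinv_l A)] :=
  coeq_desc (coeq_wtenl [:: rm_ob M] (ten_piP (coinv_r A) (coinv_l A)))
    balanced_act_subproof.

Lemma balanced_actE :
  balanced_act ∘ (id1 (rm_ob M) ⊗ ten_pi (coinv_r A) (coinv_l A))
  = ten_pi (restr_r (coinv_algP A) M) (coinv_l A) ∘ (rm_act M ⊗ id1 (ca_ob A)).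
Proof. exact: coeq_descE. Qed.

Lemma balanced_act_epi u (v : seq V)
    (f g : whom (u ++ [:: ten_over (coinv_r A) (coinv_l A)]) v) :
  f ∘ (wid u ⊗ ten_pi (coinv_r A) (coinv_l A))
  = g ∘ (wid u ⊗ ten_pi (coinv_r A) (coinv_l A)) -> f = g.
Proof. exact: (coeq_epi (coeq_wtenl u (ten_piP (coinv_r A) (coinv_l A)))). Qed.

(** [can_at M] is obtained from can by letting the first factor A act on M. This is
  what reduces its invertibility to that of can. *)
Lemma can_at_balanced_act : can_at M ∘ balanced_act
  = (rm_act M ⊗ id1 (bi_ob H)) ∘ (id1 (rm_ob M) ⊗ can A).
Proof.
apply: (@balanced_act_epi [:: x]).
rewrite -wcompA balanced_actE wcompA can_atE free_map_act -!wcompA.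
congr wcomp; wmerge; wmerge; rewrite !wcomp1 -can_at_reg.
by rewrite (can_atE reg_r) /free_map.
Qed.
End Action.

Lemma balanced_act_assoc (M : rmodule (ca_alg A)) :
  balanced_act M ∘ (id1 (rm_ob M) ⊗ balanced_act reg_r)
  = balanced_act M ∘ (rm_act M ⊗ id1 (ten_over (coinv_r A) (coinv_l A))).
Proof.
set x := rm_ob M; set xi : whom [:: x; a] [:: x] := rm_act M.
apply: (@balanced_act_epi [:: x; a]).
rewrite -!wcompA.
have -> : (xi ⊗ id1 TA) ∘ (wid [:: x; a] ⊗ pA) = xi ⊗ pA by wmerge; rewrite wcomp1 wcomp1l.
have -> : wid [:: x; a] = id1 x ⊗ id1 a by rewrite wten1.
wassoc (id1 x) (id1 a) pA; wmerge.
rewrite (balanced_actE reg_r) /= -/m -/a -/pA wcomp1.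
have -> : xi ⊗ pA = (id1 x ⊗ pA) ∘ (xi ⊗ id1 a ⊗ id1 a).
  by wmerge; rewrite wten1 wcomp1 wcomp1l.
rewrite wtenMr !wcompA balanced_actE -/xi -/x -/a -!wcompA; congr wcomp.
wassocV (id1 x) m (id1 a); wassocV xi (id1 a) (id1 a); wmerge; wmerge.
by rewrite (rm_actP M).1.
Qed.

Section Inverse.
Hypothesis galA : is_Galois A.
Variable M : rmodule (ca_alg A).
Let x := rm_ob M.
Let xi : whom [:: x; a] [:: x] := rm_act M.
Let T : V := ten_over (restr_r iP M) L.
Let p : whom [:: x; a] [:: T] := ten_pi (restr_r iP M) L.
Let act : whom [:: x; TA] [:: T] := balanced_act M.

(** The inverse is x ⊗ h |-> x · can^{-1}(1 ⊗ h), with the action of [balanced_act].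
  It is a right inverse by [can_at_balanced_act]. For the left inverse, the image
  of x ⊗ b is x b_0 · can^{-1}(1 ⊗ b_1) = x · can^{-1}(b_0 ⊗ b_1) by the left
  A-linearity of can^{-1}, and b_0 ⊗ b_1 = can (1 ⊗ b). *)
Lemma Galois_can_at_iso : is_iso (can_at M).
Proof.
case: galA => can'.
(* The equations are restated as equations of morphisms between words. *)
rewrite -[compm can' _]/(wcomp (can' : whom [:: a; h] [:: TA]) (can A)).
rewrite -[compm _ can']/(wcomp (can A) (can' : whom [:: a; h] [:: TA])).
rewrite -[idm _]/(id1 TA).
rewrite -[idm (prodw [:: ca_ob A; bi_ob H])]/(wid [:: a; h]).
move: can' => can1; pose can' : whom [:: a; h] [:: TA] := can1.
rewrite -/can' => -[canK canK'].
(* can^{-1} is left A-linear, because can is *)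
have canl : balanced_act reg_r ∘ (id1 a ⊗ can') = can' ∘ (m ⊗ id1 h).
  rewrite -[LHS]wcomp1l -[in LHS]canK -!wcompA; congr wcomp.
  rewrite wcompA -can_at_reg (can_at_balanced_act reg_r) -wcompA; wmerge.
  by rewrite canK' wcomp1 wten1 wcomp1.
(* can^{-1} (b_0 ⊗ b_1) = 1 ⊗ b *)
have can_al : can' ∘ al = pA ∘ (e ⊗ id1 a).
  rewrite -[RHS]wcomp1l -canK -!wcompA; congr wcomp.
  rewrite wcompA -can_at_reg (can_atE reg_r) /free_map /= -/m -/a -/h -/al -wcompA.
  wmerge; rewrite wcomp1 wcomp1l.
  have -> : e ⊗ al = (e ⊗ id1 a ⊗ id1 h) ∘ al.
    by rewrite -{2}[al]wten1l; wmerge; rewrite wten1 wcomp1 wcomp1l.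
  wassocV e (id1 a) (id1 h); rewrite wcompA; wmerge.
  by rewrite [m ∘ _](mul_onel (ca_alg A)) !wcomp1 wten1 wcomp1l.
pose inv : whom [:: x; h] [:: T] := act ∘ (id1 x ⊗ (can' ∘ (e ⊗ id1 h))).
exists inv; split.
- rewrite -[LHS]/(inv ∘ can_at M) -[RHS]/(id1 T); apply: ten_pi_epi1.
  rewrite wcomp1l -wcompA can_atE /free_map -/x -/xi -/a -/h -/al /inv -/p -wcompA.
  set k := can' ∘ _.
  have -> : (id1 x ⊗ k) ∘ ((xi ⊗ id1 h) ∘ (id1 x ⊗ al))
      = (xi ⊗ id1 TA) ∘ (id1 x ⊗ ((id1 a ⊗ k) ∘ al)).
    rewrite wcompA; wmerge; rewrite wcomp1 wcomp1l wtenMr wcompA; congr wcomp.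
    wassocV (id1 x) (id1 a) k; by wmerge; rewrite wten1 wcomp1 wcomp1l.
  have ball := balanced_act_assoc M; rewrite -/x -/xi -/TA -/act in ball.
  rewrite wcompA -ball -wcompA; wmerge; rewrite wcomp1 /k [id1 a ⊗ _]wtenMr.
  rewrite !wcompA canl -(wcompA can'); wassocV (id1 a) e (id1 h); wmerge.
  rewrite [m ∘ _](mul_oner (ca_alg A)) !wcomp1 wten1 wcomp1 can_al wtenMr wcompA.
  have actE := balanced_actE M; rewrite -/x -/xi -/TA -/act -/p in actE.
  rewrite actE; wassocV (id1 x) e (id1 a); rewrite -wcompA; wmerge.
  by rewrite [xi ∘ _](rm_actP M).2 wcomp1 wten1 wcomp1.
- rewrite -[LHS]/(can_at M ∘ inv) -[RHS]/(wid [:: x; h]).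
  rewrite /inv wcompA can_at_balanced_act -/x -/xi -/h -/a -wcompA; wmerge.
  rewrite wcompA canK' wcomp1 wcomp1l.
  wassocV (id1 x) e (id1 h); wmerge.
  by rewrite [xi ∘ _](rm_actP M).2 wcomp1 wten1.
Qed.
End Inverse.
End GaloisInverse.

(** * From coalgebras over the comonad to entwined modules *)

Section Transport.
Variables (V : base_category) (H : bialgebra V) (A : comodule_algebra H).
Let h : V := bi_ob H.
Let a : V := ca_ob A.
Let iP := coinv_algP A.

(** The proofs contained in two entwined modules may differ even if their actions and
  coactions agree; the identity is then an isomorphism between them. *)
Lemma idm_entwined (M : rmodule (ca_alg A)) (nu nu' : whom [:: rm_ob M] [:: rm_ob M; bi_ob H])
    nuP nu'P nuc nu'c :
  nu = nu' ->
  {s : @Hom (entwined A) (@EModule _ _ _ _ _ (entwining A) M nu nuP nuc)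
         (@EModule _ _ _ _ _ (entwining A) M nu' nu'P nu'c)
     | sval s = id1 (rm_ob M) /\ is_iso s}.
Proof.
move=> E; case: _ / E nu'P nu'c => nu'P nu'c.
rewrite (Prop_irrelevance nu'P nuP) (Prop_irrelevance nu'c nuc).
by exists (idm (EModule nuP nuc : entwined A)); split; last exact: is_iso_idm.
Qed.

Definition scalars_comonad : comonad (rmodules (ca_alg A)) :=
  adj_comonad (scalars_adjunction (coinv_algP A)).

Notation extE M := (ext_ob iP (restr_r iP M)).

Section OfCoaction.
Variables (M : rmodule (ca_alg A)).
Variable th : whom [:: rm_ob M] [:: rm_ob (ext_ob (coinv_algP A) (restr_r (coinv_algP A) M))].
Hypothesis thP : is_rlinear (X := M) (Y := ext_ob (coinv_algP A) (restr_r (coinv_algP A) M)) th.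

Lemma push_counit : (id1 (rm_ob M) ⊗ counit (bi_coalg H)) ∘ (can_at M ∘ th)
  = scal_counit (coinv_algP A) M ∘ th.
Proof. by rewrite wcompA can_at_counit. Qed.

Lemma push_compat : (can_at M ∘ th) ∘ rm_act M
  = (rm_act M ⊗ id1 (bi_ob H)) ∘ (id1 (rm_ob M) ⊗ entwining A)
    ∘ ((can_at M ∘ th) ⊗ id1 (ca_ob A)).
Proof. by rewrite -wcompA thP wcompA can_at_linear -wcompA wtenMl !wcompA. Qed.

(** This and [push_comultr] say that the coassociativity of the coaction [can_at M ∘ th] is the
  image, under the morphism M ⊗_B A ⊗_B A -> M ⊗ H ⊗ H given by [can_at] twice, of
  the coassociativity of the coalgebra structure th. *)
Lemma push_comultl :
  (can_at M ⊗ id1 (bi_ob H)) ∘ (can_at (extE M)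
    ∘ (ten_mapl (coinv_l A) (scal_unit_linear (coinv_algP A) (restr_r (coinv_algP A) M)) ∘ th))
  = (id1 (rm_ob M) ⊗ comult (bi_coalg H)) ∘ (can_at M ∘ th).
Proof. by rewrite !wcompA can_at_colinear -fbar_coact_can_at !wcompA. Qed.

Lemma push_comultr :
  (can_at M ⊗ id1 (bi_ob H)) ∘ (can_at (extE M)
    ∘ (ten_mapl (coinv_l A) (restr_linear (coinv_algP A) thP) ∘ th))
  = ((can_at M ∘ th) ⊗ id1 (bi_ob H)) ∘ (can_at M ∘ th).
Proof.
rewrite (wcompA (can_at (extE M))) (can_at_natural thP) wtenMl -!wcompA.
by [].
Qed.
End OfCoaction.

Section Object.
Variable Z : cm_coalgebra scalars_comonad.

Lemma push_comodule :
  is_rcomodule (bi_coalg H) (can_at (cmc_ob Z) ∘ sval (cmc_map Z)).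
Proof.
case: Z => M [th thP] /= c1 c2; split.
- rewrite -(push_comultr thP) -push_comultl; congr wcomp; congr wcomp.
  exact: (esym (congr1 sval c2)).
- by rewrite push_counit; apply: (congr1 sval c1).
Qed.

Definition push_ob : entwined A :=
  @EModule _ _ _ _ _ (entwining A) (cmc_ob Z) _ push_comodule
    (push_compat (proj2_sig (cmc_map Z))).
End Object.

Lemma push_colinear (Y Z : cm_coalgebra scalars_comonad) (f : cm_coalgebra_hom Y Z) :
  is_colinear (X := push_ob Y) (Y := push_ob Z) (sval (sval f)).
Proof.
rewrite /is_colinear /=; case: f => -[f fP] /= /(congr1 sval) /= fc.
rewrite -wcompA [sval (cmc_map Z) ∘ f]fc [LHS]wcompA.
by rewrite (can_at_natural fP) !wcompA.
Qed.

Program Definition push : functor (cm_coalgebras scalars_comonad) (entwined A) :=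
  @Functor (cm_coalgebras scalars_comonad) (entwined A) push_ob
    (fun Y Z f => exist _ (sval (sval f)) (conj (proj2_sig (sval f)) (push_colinear f))) _ _.
Next Obligation. by move=> Y; apply: eq_exist. Qed.
Next Obligation. by move=> X Y Z g f; apply: eq_exist. Qed.

Lemma push_comparison :
  nat_isomorphic
    (comp_functor push (comparison (scalars_adjunction (coinv_algP A)))) (fbar A).
Proof.
pose K := comp_functor push (comparison (scalars_adjunction iP)).
have t X : {s : Hom (K X) (fbar A X) | sval s = id1 (rm_ob (ext_ob iP X)) /\ is_iso s}.
  pose Z := comparison (scalars_adjunction iP) X.
  exact: (idm_entwined (push_comodule Z) (fbar_coactP X)
    (push_compat (proj2_sig (cmc_map Z))) (fbar_compat X) (fbar_coact_can_at X)).
have tN (X Y : rmodules (coinv_alg A)) (f : Hom X Y) :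
    compm (sval (t Y)) (fmap K f) = compm (fmap (fbar A) f) (sval (t X)).
  apply: eq_exist; rewrite /= (proj2_sig (t X)).1 (proj2_sig (t Y)).1.
  by rewrite wcomp1 wcomp1l.
by exists (@NatTrans _ _ K (fbar A) (fun X => sval (t X)) tN) => X; apply: (proj2_sig (t X)).2.
Qed.

Hypothesis can_iso : forall M : rmodule (ca_alg A), is_iso (can_at M).

(** When [can_at] is invertible, the coaction of any entwined module can be composed
  with its inverse to give a coalgebra structure, whose coassociativity holds
  because it holds after the two-fold [can_at], an isomorphism. *)
Lemma push_equivalence : is_equivalence push.
Proof.
apply: full_faithful_ess_equivalence.
- move=> Y Z [f [fP fc]].
  have fT : compm (cmc_map Z) (exist _ f fP)
     = compm (fmap scalars_comonad (exist _ f fP)) (cmc_map Y).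
    apply: eq_exist => /=; apply: (is_iso_mono (can_iso (cmc_ob Z))).
    rewrite -[LHS]/(can_at (cmc_ob Z) ∘ (sval (cmc_map Z) ∘ f)) wcompA.
    move: fc; rewrite /is_colinear /= => ->.
    by rewrite wcompA -(can_at_natural fP) -wcompA.
  by exists (exist _ (exist _ f fP) fT); apply: eq_exist.
- move=> Y Z [[f fP] fc] [[g gP] gc] /(congr1 sval) /= fg.
  by apply: eq_exist; apply: eq_exist.
- move=> -[M nu nuP nuc].
  have [can' [canK canK' _]] := is_iso_inv (can_iso M).
  pose c' : whom [:: rm_ob M; h] [:: rm_ob (extE M)] := can'.
  have canl : can_at M ∘ c' = wid [:: rm_ob M; h] by exact: canK'.
  pose th : whom [:: rm_ob M] [:: rm_ob (extE M)] := c' ∘ nu.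
  have thE : can_at M ∘ th = nu by rewrite /th wcompA canl wcomp1l.
  have thP : is_rlinear (X := M) (Y := extE M) th.
    apply: (is_iso_mono (can_iso M)).
    rewrite -[LHS]/(can_at M ∘ (th ∘ rm_act M)).
    rewrite -[RHS]/(can_at M ∘ (ext_act iP (restr_r iP M) ∘ (th ⊗ id1 a))).
    rewrite [LHS]wcompA thE nuc [RHS]wcompA can_at_linear -[RHS]wcompA; congr wcomp.
    by rewrite -thE wtenMl !wcompA.
  have c1 : compm (cm_counit scalars_comonad M) (exist _ th thP) = idm (M : rmodules (ca_alg A)).
    apply: eq_exist => /=; rewrite -push_counit thE; exact: nuP.2.
  have c2 : compm (cm_comult scalars_comonad M) (exist _ th thP)
      = compm (fmap scalars_comonad (exist _ th thP)) (exist _ th thP).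
    apply: eq_exist; apply: (is_iso_mono (can_iso (extE M))).
    have hiso : is_iso (can_at M ⊗ id1 h).
      exists (c' ⊗ id1 h); split.
      - rewrite -[LHS]/((c' ⊗ id1 h) ∘ (can_at M ⊗ id1 h)) -wtenM.
        have -> : c' ∘ can_at M = id1 (rm_ob (extE M)) by exact: canK.
        by rewrite wcomp1 wten1.
      - rewrite -[LHS]/((can_at M ⊗ id1 h) ∘ (c' ⊗ id1 h)) -wtenM canl.
        by rewrite wcomp1 wten1.
    apply: (is_iso_mono hiso).
    apply: etrans (push_comultl th) _; apply: esym; apply: etrans (push_comultr thP) _.
    by rewrite thE nuP.1.
  exists (CmCoalgebra c1 c2).
  have [s [_ siso]] := idm_entwined (push_comodule (CmCoalgebra c1 c2)) nuP
    (push_compat (proj2_sig (cmc_map (CmCoalgebra c1 c2)))) nuc thE.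
  by exists s.
Qed.
End Transport.

(** * The canonical morphism as a universal arrow *)

Section CofreeUniversal.
Variables (V : base_category) (H : bialgebra V) (A : comodule_algebra H).
Let h : V := bi_ob H.
Let a : V := ca_ob A.
Let iP := coinv_algP A.
Let eps : whom [:: h] [::] := counit (bi_coalg H).
Let del : whom [:: h] [:: h; h] := comult (bi_coalg H).
Variable M : rmodule (ca_alg A).
Let x := rm_ob M.
Let xi : whom [:: x; a] [:: x] := rm_act M.
Let q := cofree_fold M.
Let q' := cofree_unfold M.

Lemma can_cofreeP : is_rlinear (X := fbar_ob (restr_r (coinv_algP A) M)) (Y := cofree M)
      (cofree_fold M ∘ can_at M)
  /\ is_colinear (X := fbar_ob (restr_r (coinv_algP A) M)) (Y := cofree M)
       (cofree_fold M ∘ can_at M).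
Proof.
split.
- rewrite /is_rlinear /= -wcompA can_at_linear /cofree_act.
  rewrite wtenMl -!wcompA; do 2!congr wcomp.
  by rewrite (wcompA (cofree_unfold M ⊗ _)) -wtenMl cofree_foldK wten1 wcomp1l.
- rewrite /is_colinear /= /cofree_coact -!wcompA (wcompA (cofree_unfold M)).
  by rewrite cofree_foldK wcomp1l can_at_colinear wtenMl -wcompA.
Qed.

Definition can_cofree : Hom (fbar A (restr_r (coinv_algP A) M)) (cofree M : entwined A) :=
  exist _ _ can_cofreeP.

(** A colinear morphism into M ⊗ H is determined by its composite with the counit
  of H: this is the uniqueness in the universal property of the cofree comodule. *)
Lemma coact_counit (N : emodule (ca_alg A) (bi_coalg H) (entwining A))
    (f : whom [:: rm_ob N] [:: rm_ob M; bi_ob H]) :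
  (id1 (rm_ob M) ⊗ comult (bi_coalg H)) ∘ f = (f ⊗ id1 (bi_ob H)) ∘ em_coact N ->
  f = (((id1 (rm_ob M) ⊗ counit (bi_coalg H)) ∘ f) ⊗ id1 (bi_ob H)) ∘ em_coact N.
Proof.
move=> fc; rewrite wtenMl -wcompA -fc -/x -/h -/eps -/del.
wassoc (id1 x) eps (id1 h); rewrite wcompA; wmerge.
by rewrite (comult_counitl (bi_coalg H)) wcomp1 wten1 wcomp1l.
Qed.

Section Unfold.
Variables (N : emodule (ca_alg A) (bi_coalg H) (entwining A)).
Variable r : @Hom (entwined A) N (cofree M).

Lemma unfold_colinear :
  (id1 (rm_ob M) ⊗ comult (bi_coalg H)) ∘ (cofree_unfold M ∘ sval r)
  = ((cofree_unfold M ∘ sval r) ⊗ id1 (bi_ob H)) ∘ em_coact N.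
Proof.
have := (proj2_sig r).2; rewrite /is_colinear /= /cofree_coact => E.
rewrite wtenMl -[RHS]wcompA -[X in _ = _ ∘ X]E -!wcompA.
by rewrite (wcompA (cofree_unfold M ⊗ _)) -wtenMl cofree_foldK wten1 wcomp1l.
Qed.

(** The A-linear morphism N -> M that corresponds to an entwined morphism from N to
  the cofree entwined module on M. *)
Definition unfold_counit : whom [:: rm_ob N] [:: rm_ob M] :=
  (id1 (rm_ob M) ⊗ counit (bi_coalg H)) ∘ (cofree_unfold M ∘ sval r).

Lemma unfold_counit_linear : is_rlinear (X := N) (Y := M) unfold_counit.
Proof.
have := (proj2_sig r).1; rewrite /is_rlinear /= /cofree_act /unfold_counit => E.
rewrite -!wcompA E.
set r0 := sval r; rewrite -/q' -/q -/x -/xi -/h -/a -/eps; layers.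
layer_rewrite (cofree_foldK M) (@nil V) (@nil V).
exchange.
by layer_rewrite (entwining_counit A) [:: x] (@nil V).
Qed.
End Unfold.

Lemma cofree_hom_ext (N : emodule (ca_alg A) (bi_coalg H) (entwining A))
    (r s : @Hom (entwined A) N (cofree M)) :
  unfold_counit r = unfold_counit s -> r = s.
Proof.
move=> E; have e1 := coact_counit (unfold_colinear r).
have e2 := coact_counit (unfold_colinear s).
rewrite -/(unfold_counit r) E /unfold_counit -e2 in e1.
have /(congr1 (fun t => cofree_fold M ∘ t)) := e1.
rewrite !wcompA cofree_unfoldK !wcomp1l.
by case: r s {E e1 e2} => [r rP] [s sP] /= rs; apply: eq_exist.
Qed.

Lemma unfold_counit_can (N : emodule (ca_alg A) (bi_coalg H) (entwining A))
    (s : @Hom (entwined A) N (fbar A (restr_r (coinv_algP A) M))) :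
  unfold_counit (compm can_cofree s) = scal_counit (coinv_algP A) M ∘ sval s.
Proof.
rewrite /unfold_counit /= -can_at_counit !wcompA.
by rewrite -(wcompA _ (cofree_unfold M)) cofree_foldK wcomp1.
Qed.

(** Composition with the counit of H turns [can_cofree] into the counit M ⊗_B A -> M
  of the adjunction of scalars ([unfold_counit_can]) and is injective on entwined
  morphisms ([cofree_hom_ext]), so the universal property is that of the counit. *)
Lemma can_cofree_universal : universal_arrow can_cofree.
Proof.
move=> X r.
pose g : Hom (extension iP X) (M : rmodules (ca_alg A)) :=
  exist _ _ (unfold_counit_linear r).
have [u [uE uU]] := counit_universal (scalars_adjunction iP) g.
have uE' v : compm (adj_counit (scalars_adjunction iP) M) (fmap (extension iP) v) = g <->
    compm can_cofree (fmap (fbar A) v) = r.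
  split=> [/(congr1 sval) /= E|E].
  - apply: (@cofree_hom_ext (fbar_ob X)).
    exact: etrans (@unfold_counit_can (fbar_ob X) (fmap (fbar A) v)) E.
  - apply: eq_exist; rewrite /= -E.
    exact: esym (@unfold_counit_can (fbar_ob X) (fmap (fbar A) v)).
exists u; split; first exact/uE'.
by move=> v /uE' /uU.
Qed.

Lemma can_cofree_iso : is_iso can_cofree -> is_iso (can_at M).
Proof.
move=> [r [rK rK']].
have {}rK : sval r ∘ (cofree_fold M ∘ can_at M) = id1 _ := congr1 sval rK.
have {}rK' : (cofree_fold M ∘ can_at M) ∘ sval r = id1 _ := congr1 sval rK'.
exists (sval r ∘ cofree_fold M); split.
- by rewrite -[LHS]/((sval r ∘ cofree_fold M) ∘ can_at M) -wcompA.
- rewrite -[LHS]/(can_at M ∘ (sval r ∘ cofree_fold M)).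
  rewrite -[LHS]wcomp1l -[in LHS]cofree_foldK -wcompA.
  rewrite (wcompA (cofree_fold M) (can_at M)) (wcompA (cofree_fold M ∘ can_at M)).
  by rewrite rK' wcomp1l cofree_foldK.
Qed.
End CofreeUniversal.

(** * Equivalence, comonadicity and the Galois condition *)

Theorem theorem5p12 (V : base_category) (H : bialgebra V) (A : comodule_algebra H) :
  is_equivalence (fbar A)
  <-> (is_comonadic (F := extension (coinv_algP A)) (scalars_adjunction (coinv_algP A))
       /\ is_Galois A).
Proof.
have galP : is_Galois A -> is_equivalence (push A).
  by move=> galA; apply: push_equivalence => M; apply: Galois_can_at_iso.
split=> [eqv | [com galA]]; last first.
  exact/(equivalence_left_factor (galP galA) (push_comparison A)).
have galA : is_Galois A.
  have [fu _ es] := equivalence_full_faithful_ess eqv.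
  rewrite /is_Galois -can_at_reg; apply: can_cofree_iso.
  exact: (universal_arrow_iso fu es (can_cofree_universal (M := reg_r A))).
by split=> //; apply/(equivalence_left_factor (galP galA) (push_comparison A)).
Qed.
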